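(* The group $B_3/[B_3[4],B_3[4]]$ is crystallographic with dimension $6$ and holonomy group the symmetric group $S_4$.
   Context: $B_3=\langle \sigma_1,\sigma_2\mid \sigma_1\sigma_2\sigma_1=\sigma_2\sigma_1\sigma_2\rangle$ is the braid group on three strands. $\rho_4\colon B_3\to \mathrm{Sp}_2(\mathbb{Z}/4\mathbb{Z})=\mathrm{SL}_2(\mathbb{Z}/4\mathbb{Z})$ is the homomorphism (integral Burau representation at $t=-1$, reduced mod $4$) given by $\sigma_1\mapsto\begin{pmatrix}1&1\\0&1\end{pmatrix}$, $\sigma_2\mapsto\begin{pmatrix}1&0\\-1&1\end{pmatrix}$, and $B_3[4]=\ker\rho_4$ is the level $4$ congruence subgroup. A group is crystallographic of dimension $d$ if it is (isomorphic to) a discrete uniform (i.e. cocompact) subgroup of $\mathbb{R}^d\rtimes \mathrm{O}(d,\mathbb{R})$. Equivalently, $\Pi$ is crystallographic of dimension $d$ with holonomy group $\Phi$ if $\Phi$ is finite and there is a short exact sequence $0\to\mathbb{Z}^d\to\Pi\to\Phi\to1$ such that the representation $\Phi\to\mathrm{Aut}(\mathbb{Z}^d)$ induced by conjugation is faithful. *)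

(* Defs.v *)
From HB Require Import structures.
From mathcomp Require Import fingroup perm.
From mathcomp Require Import all_boot all_order all_algebra.
From mathcomp Require Import all_classical all_reals all_analysis.

Set Implicit Arguments.
Unset Strict Implicit.
Unset Printing Implicit Defensive.

Import Order.TTheory GRing.Theory Num.Theory.
Import numFieldNormedType.Exports.

Local Open Scope classical_set_scope.
Local Open Scope group_scope.
Local Open Scope quotient_scope.

(* Subgroups of a possibly infinite group are the boolean predicates of type
   [groupClosed G]. *)

HB.mixin Record isConjClosed (G : groupType) (S : {pred G}) := {
  gpredJr : forall x y : G, x \in S -> x ^ y \in S
}.

#[short(type="normalClosed")]
HB.structure Definition NormalClosed G :=
  {S of GroupClosed G S & isConjClosed G S}.

Section Kernel.
Variables (G H : groupType) (f : UMagmaMorphism.type G H).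

Definition gker : {pred G} := [pred x | f x == 1].

Lemma gker_mulg_closed : mulg_closed gker.
Proof. by move=> x y /eqP fx /eqP fy; rewrite inE gmulfM fx fy mulg1. Qed.

Lemma gker1 : 1 \in gker.
Proof. by rewrite inE gmulf1. Qed.

Lemma gker_invg_closed : invg_closed gker.
Proof.
move=> x /eqP fx; apply/eqP/(mulgI (f x)).
by rewrite -gmulfM mulgV gmulf1 fx mulg1.
Qed.

HB.instance Definition _ := isMulClosed.Build G gker gker_mulg_closed.
HB.instance Definition _ := isMul1Closed.Build G gker gker1.
HB.instance Definition _ := isInvClosed.Build G gker gker_invg_closed.

Lemma gkerJ x y : x \in gker -> x ^ y \in gker.
Proof.
move=> /eqP fx; apply/eqP.
by rewrite !gmulfM fx mul1g -gmulfM mulVg gmulf1.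
Qed.

HB.instance Definition _ := isConjClosed.Build G gker gkerJ.

End Kernel.

Section Generated.
Variables (G : groupType).

(* The subgroup generated by S: the intersection of the subgroups containing S. *)
Definition ggen (S : set G) : {pred G} :=
  fun x => `[< forall K : groupClosed G,
                 (forall y, S y -> y \in K) -> x \in K >].

Section GgenGroup.
Variable S : set G.

Lemma ggen_mulg_closed : mulg_closed (ggen S).
Proof.
move=> x y /asboolP Sx /asboolP Sy; apply/asboolP => K SK.
by apply: gpredM; [exact: Sx|exact: Sy].
Qed.

Lemma ggen1 : 1 \in ggen S.
Proof. by apply/asboolP => K _; exact: gpred1. Qed.

Lemma ggen_invg_closed : invg_closed (ggen S).
Proof.
by move=> x /asboolP Sx; apply/asboolP => K SK; apply/gpredVr/Sx.
Qed.

HB.instance Definition _ := isMulClosed.Build G (ggen S) ggen_mulg_closed.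
HB.instance Definition _ := isMul1Closed.Build G (ggen S) ggen1.
HB.instance Definition _ := isInvClosed.Build G (ggen S) ggen_invg_closed.

End GgenGroup.

Lemma sub_ggen (S : set G) x : S x -> x \in ggen S.
Proof. by move=> Sx; apply/asboolP => K; apply. Qed.

Section ConjPreimage.
Variables (K : groupClosed G) (z : G).

Definition conj_preim : {pred G} := [pred x | x ^ z \in K].

Lemma conjp_mulg_closed : mulg_closed conj_preim.
Proof.
by move=> x y; rewrite !inE => Kx Ky; rewrite conjMg; exact: gpredM.
Qed.

Lemma conjp1 : 1 \in conj_preim.
Proof. by rewrite inE conj1g gpred1. Qed.

Lemma conjp_invg_closed : invg_closed conj_preim.
Proof. by move=> x; rewrite !inE => Kx; rewrite conjVg; exact: gpredVr. Qed.

HB.instance Definition _ := isMulClosed.Build G conj_preim conjp_mulg_closed.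
HB.instance Definition _ := isMul1Closed.Build G conj_preim conjp1.
HB.instance Definition _ := isInvClosed.Build G conj_preim conjp_invg_closed.

End ConjPreimage.

Lemma ggenJ (S : set G) (SJ : forall x z, S x -> S (x ^ z)) x z :
  x \in ggen S -> x ^ z \in ggen S.
Proof.
move=> /asboolP Sx; apply/asboolP => K SK.
apply: (Sx (conj_preim K z)) => y Sy; exact/SK/SJ.
Qed.

(* The commutator subgroup [A, B]. *)
Definition gcomm (A B : {pred G}) : {pred G} :=
  ggen [set z | exists x y, [/\ x \in A, y \in B & z = [~ x, y]]].

Section GcommNormal.
Variables A B : normalClosed G.

HB.instance Definition _ := GroupClosed.on (gcomm A B).

Lemma gcommJ x z : x \in gcomm A B -> x ^ z \in gcomm A B.
Proof.
apply: ggenJ => {}x {}z [a] [b] [Aa Bb ->].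
exists (a ^ z), (b ^ z).
by split; [exact: gpredJr|exact: gpredJr|rewrite conjRg].
Qed.

HB.instance Definition _ := isConjClosed.Build G (gcomm A B) gcommJ.

End GcommNormal.
End Generated.

Section Cosets.
Variables (G : groupType) (H : groupClosed G).

(* x H = y H *)
Definition lcoset_eq : rel G := fun x y => x^-1 * y \in H.

Lemma lcoset_eq_refl : reflexive lcoset_eq.
Proof. by move=> x; rewrite /lcoset_eq mulVg gpred1. Qed.

Lemma lcoset_eq_sym : symmetric lcoset_eq.
Proof. by move=> x y; rewrite /lcoset_eq -gpredV invgM invgK. Qed.

Lemma lcoset_eq_trans : transitive lcoset_eq.
Proof.
move=> y x z Hxy Hyz; rewrite /lcoset_eq.
by have := gpredM _ _ Hxy Hyz; rewrite -mulgA mulVKg.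
Qed.

Canonical lcoset_equiv :=
  EquivRel lcoset_eq lcoset_eq_refl lcoset_eq_sym lcoset_eq_trans.

Definition coset_space := {eq_quot lcoset_eq}.

End Cosets.

Section QuotientGroup.
Variables (G : groupType) (N : normalClosed G).

Definition quotient_group := {eq_quot (@lcoset_eq G N)}.

HB.instance Definition _ := Choice.on quotient_group.
HB.instance Definition _ := EqQuotient.on quotient_group.

Local Notation Q := quotient_group.

Lemma quotient_eqP (x y : G) : reflect (x = y %[mod Q]) (x^-1 * y \in N).
Proof. by apply: (iffP idP) => [Nxy|/eqmodP//]; apply/eqmodP. Qed.

Lemma quotient_surj (a : Q) : exists x, a = \pi_Q x.
Proof. by exists (repr a); rewrite reprK. Qed.

Definition quotient_one : Q := \pi_Q 1.
Definition quotient_mul (a b : Q) : Q := \pi_Q (repr a * repr b).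
Definition quotient_inv (a : Q) : Q := \pi_Q (repr a)^-1.

Lemma quotient_mulE (x y : G) :
  quotient_mul (\pi_Q x) (\pi_Q y) = \pi_Q (x * y).
Proof.
apply/quotient_eqP.
have /quotient_eqP Nx : repr (\pi_Q x) = x %[mod Q] by rewrite reprK.
have /quotient_eqP Ny : repr (\pi_Q y) = y %[mod Q] by rewrite reprK.
rewrite invgM; set x' := repr _ in Nx *; set y' := repr _ in Ny *.
have -> : y'^-1 * x'^-1 * (x * y) = (x'^-1 * x) ^ y' * (y'^-1 * y).
  by rewrite /conjg !mulgA mulgK.
by apply: gpredM => //; exact: gpredJr.
Qed.

Lemma quotient_invE (x : G) : quotient_inv (\pi_Q x) = \pi_Q x^-1.
Proof.
apply/quotient_eqP; rewrite invgK.
have /quotient_eqP : x = repr (\pi_Q x) %[mod Q] by rewrite reprK.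
set x' := repr _; move=> /(gpredJr _ x^-1).
by rewrite /conjg invgK !mulgA mulgV mul1g.
Qed.

Lemma quotient_mulA : associative quotient_mul.
Proof.
move=> a b c; have [x ->] := quotient_surj a; have [y ->] := quotient_surj b.
by have [z ->] := quotient_surj c; rewrite !quotient_mulE mulgA.
Qed.

Lemma quotient_1mul : left_id quotient_one quotient_mul.
Proof.
by move=> a; have [x ->] := quotient_surj a; rewrite quotient_mulE mul1g.
Qed.

Lemma quotient_mul1 : right_id quotient_one quotient_mul.
Proof.
by move=> a; have [x ->] := quotient_surj a; rewrite quotient_mulE mulg1.
Qed.

Lemma quotient_Vmul : left_inverse quotient_one quotient_inv quotient_mul.
Proof.
by move=> a; have [x ->] := quotient_surj a; rewrite quotient_invE quotient_mulE mulVg.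
Qed.

Lemma quotient_mulV : right_inverse quotient_one quotient_inv quotient_mul.
Proof.
by move=> a; have [x ->] := quotient_surj a; rewrite quotient_invE quotient_mulE mulgV.
Qed.

HB.instance Definition _ := isGroup.Build quotient_group quotient_mulA
  quotient_1mul quotient_mul1 quotient_Vmul quotient_mulV.

End QuotientGroup.

Section Presentation.
Variable I : choiceType.

(* [(i, true)] stands for the generator [i], [(i, false)] for its inverse. *)
Definition word := seq (I * bool).

Definition word_inv (w : word) : word := rev [seq (l.1, ~~ l.2) | l <- w].

Variable rels : set (word * word).

Inductive word_eq : word -> word -> Prop :=
| word_eq_refl w : word_eq w w
| word_eq_sym v w : word_eq v w -> word_eq w v
| word_eq_trans u v w : word_eq u v -> word_eq v w -> word_eq u w
| word_eq_cat v v' w w' : word_eq v v' -> word_eq w w' ->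
    word_eq (v ++ w) (v' ++ w')
| word_eq_cancel i b : word_eq [:: (i, b); (i, ~~ b)] [::]
| word_eq_rel r : rels r -> word_eq r.1 r.2.

Definition word_eqb : rel word := fun v w => `[< word_eq v w >].

Lemma word_eqb_refl : reflexive word_eqb.
Proof. by move=> w; apply/asboolP; exact: word_eq_refl. Qed.

Lemma word_eqb_sym : symmetric word_eqb.
Proof. by move=> v w; apply/asboolP/asboolP; exact: word_eq_sym. Qed.

Lemma word_eqb_trans : transitive word_eqb.
Proof.
by move=> v u w /asboolP uv /asboolP vw; apply/asboolP; exact: word_eq_trans vw.
Qed.

Canonical word_equiv :=
  EquivRel word_eqb word_eqb_refl word_eqb_sym word_eqb_trans.

Definition presented_group := {eq_quot word_eqb}.

HB.instance Definition _ := Choice.on presented_group.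
HB.instance Definition _ := EqQuotient.on presented_group.

Local Notation P := presented_group.

Lemma presented_eqP (v w : word) : reflect (v = w %[mod P]) `[< word_eq v w >].
Proof. by apply: (iffP idP) => [vw|/eqmodP//]; apply/eqmodP. Qed.

Lemma word_invK : involutive word_inv.
Proof.
move=> w; rewrite /word_inv map_rev revK -map_comp -[RHS]map_id.
by apply: eq_map => -[i b] /=; rewrite negbK.
Qed.

Lemma word_eq_catl u v w : word_eq v w -> word_eq (u ++ v) (u ++ w).
Proof. by apply: word_eq_cat; exact: word_eq_refl. Qed.

Lemma word_eq_catr u v w : word_eq v w -> word_eq (v ++ u) (w ++ u).
Proof. by move=> vw; apply: word_eq_cat vw _; exact: word_eq_refl. Qed.

Lemma word_eq_invl w : word_eq (word_inv w ++ w) [::].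
Proof.
elim: w => [|[i b] w IH]; first exact: word_eq_refl.
rewrite /word_inv /= rev_cons cat_rcons.
apply: word_eq_trans IH; apply: word_eq_catl.
apply: (@word_eq_catr w [:: (i, ~~ b); (i, b)] [::]).
by have := word_eq_cancel i (~~ b); rewrite negbK.
Qed.

Lemma word_eq_invr w : word_eq (w ++ word_inv w) [::].
Proof. by have := word_eq_invl (word_inv w); rewrite word_invK. Qed.

Lemma word_eq_inv v w : word_eq v w -> word_eq (word_inv v) (word_inv w).
Proof.
move=> vw; have := word_eq_catl (word_inv v) (word_eq_invr w).
rewrite cats0 catA => /word_eq_sym/word_eq_trans; apply.
apply: (@word_eq_catr (word_inv w) _ [::]).
by apply: word_eq_trans (word_eq_invl v); apply/word_eq_catl/word_eq_sym.
Qed.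

Lemma presented_surj (a : P) : exists w, a = \pi_P w.
Proof. by exists (repr a); rewrite reprK. Qed.

Definition presented_one : P := \pi_P [::].
Definition presented_mul (a b : P) : P := \pi_P (repr a ++ repr b).
Definition presented_inv (a : P) : P := \pi_P (word_inv (repr a)).

Lemma repr_word_eq (w : word) : word_eq (repr (\pi_P w)) w.
Proof. by apply/asboolP/presented_eqP; rewrite reprK. Qed.

Lemma presented_mulE (v w : word) :
  presented_mul (\pi_P v) (\pi_P w) = \pi_P (v ++ w).
Proof.
by apply/presented_eqP/asboolP; apply: word_eq_cat; exact: repr_word_eq.
Qed.

Lemma presented_invE (w : word) :
  presented_inv (\pi_P w) = \pi_P (word_inv w).
Proof. by apply/presented_eqP/asboolP/word_eq_inv/repr_word_eq. Qed.

Lemma presented_mulA : associative presented_mul.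
Proof.
move=> a b c; have [x ->] := presented_surj a; have [y ->] := presented_surj b.
by have [z ->] := presented_surj c; rewrite !presented_mulE catA.
Qed.

Lemma presented_1mul : left_id presented_one presented_mul.
Proof. by move=> a; have [x ->] := presented_surj a; rewrite presented_mulE. Qed.

Lemma presented_mul1 : right_id presented_one presented_mul.
Proof. by move=> a; have [x ->] := presented_surj a; rewrite presented_mulE cats0. Qed.

Lemma presented_Vmul : left_inverse presented_one presented_inv presented_mul.
Proof.
move=> a; have [x ->] := presented_surj a; rewrite presented_invE presented_mulE.
exact/presented_eqP/asboolP/word_eq_invl.
Qed.

Lemma presented_mulV : right_inverse presented_one presented_inv presented_mul.
Proof.
move=> a; have [x ->] := presented_surj a; rewrite presented_invE presented_mulE.
exact/presented_eqP/asboolP/word_eq_invr.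
Qed.

HB.instance Definition _ := isGroup.Build presented_group presented_mulA
  presented_1mul presented_mul1 presented_Vmul presented_mulV.

Definition presented_gen (i : I) : P := \pi_P [:: (i, true)].

Section Lift.
Variables (H : groupType) (f : I -> H).

Definition word_eval (w : word) : H :=
  \prod_(l <- w) (if l.2 then f l.1 else (f l.1)^-1).

Hypothesis f_rels : forall r, rels r -> word_eval r.1 = word_eval r.2.

Lemma word_eval_eq v w : word_eq v w -> word_eval v = word_eval w.
Proof.
elim=> // [u v' w' _ -> _ ->//|v1 v2 w1 w2 _ e1 _ e2|i b].
  by rewrite /word_eval !big_cat /= -/(word_eval _) e1 -/(word_eval w1) e2.
by rewrite /word_eval !big_cons !big_nil /= mulg1; case: b; rewrite ?mulgV ?mulVg.
Qed.

Definition presented_lift (x : P) : H := word_eval (repr x).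

Lemma presented_liftE w : presented_lift (\pi_P w) = word_eval w.
Proof. exact/word_eval_eq/repr_word_eq. Qed.

Lemma presented_lift_gen i : presented_lift (presented_gen i) = f i.
Proof. by rewrite presented_liftE /word_eval big_seq1. Qed.

Lemma presented_lift_morphism : monoid.monoid_morphism presented_lift.
Proof.
split; first by rewrite presented_liftE /word_eval big_nil.
move=> a b; have [x ->] := presented_surj a; have [y ->] := presented_surj b.
by rewrite [_ * _]presented_mulE !presented_liftE /word_eval big_cat.
Qed.

End Lift.
End Presentation.

Section SpecialLinear.
Variables (n : nat) (R : comUnitRingType).
Local Open Scope ring_scope.

Definition SL : Type := {A : 'M[R]_n | \det A == 1}.
HB.instance Definition _ := Choice.on SL.
HB.instance Definition _ := SubChoice.on SL.

Lemma SL_unit (A : SL) : \val A \in unitmx.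
Proof. by rewrite unitmxE (eqP (valP A)) unitr1. Qed.

Lemma SL_one_subproof : \det (1%:M : 'M[R]_n) == 1.
Proof. by rewrite det1. Qed.

Lemma SL_mul_subproof (A B : SL) : \det (\val A *m \val B) == 1.
Proof. by rewrite det_mulmx (eqP (valP A)) (eqP (valP B)) mulr1. Qed.

Lemma SL_inv_subproof (A : SL) : \det (invmx (\val A)) == 1.
Proof. by rewrite det_inv (eqP (valP A)) invr1. Qed.

Definition SL_one : SL := exist _ 1%:M SL_one_subproof.
Definition SL_mul (A B : SL) : SL := exist _ (\val A *m \val B) (SL_mul_subproof A B).
Definition SL_inv (A : SL) : SL := exist _ (invmx (\val A)) (SL_inv_subproof A).

Lemma SL_mulA : associative SL_mul.
Proof. by move=> A B C; apply: val_inj; rewrite /= mulmxA. Qed.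
Lemma SL_1mul : left_id SL_one SL_mul.
Proof. by move=> A; apply: val_inj; rewrite /= mul1mx. Qed.
Lemma SL_mul1 : right_id SL_one SL_mul.
Proof. by move=> A; apply: val_inj; rewrite /= mulmx1. Qed.
Lemma SL_Vmul : left_inverse SL_one SL_inv SL_mul.
Proof. by move=> A; apply: val_inj; rewrite /= mulVmx ?SL_unit. Qed.
Lemma SL_mulV : right_inverse SL_one SL_inv SL_mul.
Proof. by move=> A; apply: val_inj; rewrite /= mulmxV ?SL_unit. Qed.

HB.instance Definition _ :=
  isGroup.Build SL SL_mulA SL_1mul SL_mul1 SL_Vmul SL_mulV.

End SpecialLinear.

Section BraidGroup.

Definition sg1 : 'I_2 := ord0.
Definition sg2 : 'I_2 := ord_max.

Definition braid_rels : set (word 'I_2 * word 'I_2) :=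
  [set ([:: (sg1, true); (sg2, true); (sg1, true)],
        [:: (sg2, true); (sg1, true); (sg2, true)])].

Definition B3 := presented_group braid_rels.
HB.instance Definition _ := Group.on B3.

Definition sigma (i : 'I_2) : B3 := presented_gen braid_rels i.

Lemma sigma_braid :
  sigma sg1 * sigma sg2 * sigma sg1 = sigma sg2 * sigma sg1 * sigma sg2.
Proof.
have sigma3E i j k : sigma i * sigma j * sigma k =
    \pi_(presented_group braid_rels) [:: (i, true); (j, true); (k, true)].
  by rewrite [sigma i * sigma j]presented_mulE [LHS]presented_mulE.
rewrite !sigma3E; apply/presented_eqP/asboolP.
exact: (word_eq_rel (r := (_, _))).
Qed.

Local Open Scope ring_scope.

Definition mx22 (R : Type) (a b c d : R) : 'M[R]_2 :=
  \matrix_(i, j) if i == 0 :> 'I_2 then (if j == 0 :> 'I_2 then a else b)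
                 else (if j == 0 :> 'I_2 then c else d).

Definition burau_mx (i : 'I_2) : 'M['Z_4]_2 :=
  if i == sg1 then mx22 1 1 0 1 else mx22 1 0 (-1) 1.

Lemma burau_det i : \det (burau_mx i) == 1.
Proof.
rewrite (expand_det_row _ 0) !big_ord_recl big_ord0 /cofactor !det_mx11.
by rewrite /burau_mx; case: (i == sg1); rewrite !mxE.
Qed.

Definition burau_gen (i : 'I_2) : SL 2 'Z_4 := exist _ (burau_mx i) (burau_det i).

Definition rho4 : B3 -> SL 2 'Z_4 := @presented_lift _ braid_rels _ burau_gen.

Lemma burau_rels r : braid_rels r ->
  word_eval burau_gen r.1 = word_eval burau_gen r.2.
Proof.
move=> ->; apply/val_inj/matrixP => a b; rewrite /word_eval !big_cons !big_nil /=.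
rewrite /burau_mx !eqxx /= !mulmx1 !mxE !big_ord_recl !big_ord0 !mxE.
rewrite !big_ord_recl !big_ord0 !mxE.
by case: a => -[|[|//]] ?; case: b => -[|[|//]] ?; apply/val_inj.
Qed.

HB.instance Definition _ := isUMagmaMorphism.Build B3 (SL 2 'Z_4) rho4
  (presented_lift_morphism burau_rels).

Lemma rho4_sigma i : \val (rho4 (sigma i)) = burau_mx i.
Proof. by rewrite /rho4 presented_lift_gen //; exact: burau_rels. Qed.

End BraidGroup.

Section EuclideanGroup.
Variables (R : realType) (d : nat).

Local Open Scope ring_scope.

Definition orth : Type := {A : 'M[R]_d | A *m A^T == 1%:M}.
HB.instance Definition _ := SubChoice.on orth.
HB.instance Definition _ :=
  Topological.copy orth (initial_topology (\val : orth -> 'M[R]_d)).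

Lemma orth_mulmxT (A : orth) : \val A *m (\val A)^T = 1%:M.
Proof. exact/eqP/(valP A). Qed.

Lemma orth_mulTmx (A : orth) : (\val A)^T *m \val A = 1%:M.
Proof. exact/mulmx1C/orth_mulmxT. Qed.

Lemma orth_one_subproof : (1%:M : 'M[R]_d) *m 1%:M^T == 1%:M.
Proof. by rewrite mul1mx trmx1. Qed.

Lemma orth_mul_subproof (A B : orth) :
  (\val A *m \val B) *m (\val A *m \val B)^T == 1%:M.
Proof.
by rewrite trmx_mul mulmxA -(mulmxA (\val A)) orth_mulmxT mulmx1 orth_mulmxT.
Qed.

Lemma orth_inv_subproof (A : orth) : (\val A)^T *m (\val A)^T^T == 1%:M.
Proof. by rewrite trmxK orth_mulTmx. Qed.

Definition orth_one : orth := exist _ 1%:M orth_one_subproof.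
Definition orth_mul (A B : orth) : orth :=
  exist _ (\val A *m \val B) (orth_mul_subproof A B).
Definition orth_inv (A : orth) : orth := exist _ (\val A)^T (orth_inv_subproof A).

Lemma orth_mulA : associative orth_mul.
Proof. by move=> A B C; apply: val_inj; rewrite /= mulmxA. Qed.
Lemma orth_1mul : left_id orth_one orth_mul.
Proof. by move=> A; apply: val_inj; rewrite /= mul1mx. Qed.
Lemma orth_mul1 : right_id orth_one orth_mul.
Proof. by move=> A; apply: val_inj; rewrite /= mulmx1. Qed.
Lemma orth_Vmul : left_inverse orth_one orth_inv orth_mul.
Proof. by move=> A; apply: val_inj; rewrite /= orth_mulTmx. Qed.
Lemma orth_mulV : right_inverse orth_one orth_inv orth_mul.
Proof. by move=> A; apply: val_inj; rewrite /= orth_mulmxT. Qed.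

HB.instance Definition _ :=
  isGroup.Build orth orth_mulA orth_1mul orth_mul1 orth_Vmul orth_mulV.

(* The semidirect product of the translations of R^d and O(d): (v, A) stands
   for the isometry x |-> v + A x. *)
Definition euclid : Type := ('cV[R]_d * orth)%type.
HB.instance Definition _ := Choice.copy euclid ('cV[R]_d * orth)%type.
HB.instance Definition _ := Topological.copy euclid ('cV[R]_d * orth)%type.

Definition euclid_one : euclid := (0, 1%g).
Definition euclid_mul (x y : euclid) : euclid :=
  (x.1 + \val x.2 *m y.1, (x.2 * y.2)%g).
Definition euclid_inv (x : euclid) : euclid :=
  (- (\val (x.2^-1)%g *m x.1), (x.2^-1)%g).

Lemma euclid_mulA : associative euclid_mul.
Proof.
by move=> x y z; rewrite /euclid_mul /= mulmxDr addrA mulmxA mulgA.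
Qed.
Lemma euclid_1mul : left_id euclid_one euclid_mul.
Proof. by case=> v A; rewrite /euclid_mul /= mul1mx add0r mul1g. Qed.
Lemma euclid_mul1 : right_id euclid_one euclid_mul.
Proof. by case=> v A; rewrite /euclid_mul /= mulmx0 addr0 mulg1. Qed.
Lemma euclid_Vmul : left_inverse euclid_one euclid_inv euclid_mul.
Proof. by case=> v A; rewrite /euclid_mul /= addNr mulVg. Qed.
Lemma euclid_mulV : right_inverse euclid_one euclid_inv euclid_mul.
Proof.
by case=> v A; rewrite /euclid_mul /= mulmxN mulmxA orth_mulmxT mul1mx subrr mulgV.
Qed.

HB.instance Definition _ :=
  isGroup.Build euclid euclid_mulA euclid_1mul euclid_mul1 euclid_Vmul euclid_mulV.

Definition discrete_subgroup (K : groupClosed euclid) : Prop :=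
  [set` K] `<=` isolated [set` K].

(* Cocompactness: the coset space (R^d >| O(d)) / K, with the quotient topology,
   is compact. *)
Definition uniform_subgroup (K : groupClosed euclid) : Prop :=
  compact [set: quotient_topology (coset_space K)].

Definition crystallographic (P : groupType) : Prop :=
  exists (K : groupClosed euclid) (f : UMagmaMorphism.type P euclid),
    [/\ discrete_subgroup K, uniform_subgroup K, injective f
      & forall y, y \in K <-> exists x, y = f x].

End EuclideanGroup.

(* The extension 0 -> Z^d -> P -> Phi -> 1; the last clause says that the
   automorphisms of Z^d induced by conjugation by x and y are equal only if x
   and y have the same image in Phi. *)
Definition has_holonomy (d : nat) (P : groupType) (Phi : finGroupType) : Prop :=
  exists (i : 'cV[int]_d -> P) (p : UMagmaMorphism.type P Phi),
    [/\ {morph i : u v / (u + v)%R >-> u * v},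
        injective i,
        (forall x, p x = 1 <-> exists u, x = i u),
        (forall s, exists x, p x = s)
      & forall x y, (forall u, x * i u * x^-1 = y * i u * y^-1) -> p x = p y].

Definition B3_4 : {pred B3} := gker rho4.
HB.instance Definition _ := NormalClosed.on B3_4.

(* Main.v *)
Require Import Defs.
From mathcomp Require Import all_boot fingroup perm.
From mathcomp Require Import reals.
From HB Require Import structures.
From mathcomp Require Import all_order all_algebra.
From mathcomp Require Import all_classical all_analysis.
From mathcomp Require Import ring lra zify.

(** Write a, b for the generators and z = (ab)^3 for the central full twist.
    SL_2(Z/4) permutes the six cusps of level 4, so B_3 acts on six points, and
    the kernel of this action is the preimage of {1, -1}, with quotient S_4.
    To a cusp corresponds a conjugate of a, and its fourth power c_j lies in
    B_3[4]; the c_j commute modulo [B_3[4], B_3[4]], they are permuted like the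
    cusps, and their product is z^4. The group generated by z and the c_j
    contains the whole kernel of the action, because the presentation of B_3
    together with a^4 = z = 1 leaves at most the 24 elements a^k h_j, where h_j
    moves the cusp of a to the j-th one.
    Conversely B_3 acts on R^6 by isometries, through permutation matrices and
    integral translation parts, in such a way that c_j is the translation by
    4 e_j and z is the translation by (1, ..., 1). This action is trivial on
    [B_3[4], B_3[4]], and the only relation between these seven translations is
    the one already found, so it is faithful on the quotient. *)

Set Implicit Arguments.
Unset Strict Implicit.
Unset Printing Implicit Defensive.

(** * Consequences of the braid relation in an arbitrary group *)

Section BraidRelation.
Local Open Scope group_scope.
Variables (G : groupType) (a b : G).
Hypothesis ab : a * b * a = b * a * b.

(** Conjugation by the half twist [a * b * a] exchanges [a] and [b], so its square commutes with
    both. *)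
Definition full_twist : G := a * b * a * (a * b * a).
Local Notation z := full_twist.

Let swap1 : a * (a * b * a) = a * b * a * b.
Proof. by rewrite {1}ab !mulgA. Qed.

Let swap2 : b * (a * b * a) = a * b * a * a.
Proof. by rewrite !mulgA -ab. Qed.

Lemma full_twist_commutel : commute z a.
Proof.
rewrite /commute /full_twist; move: (a * b * a) swap1 swap2 => d s1 s2.
by rewrite -mulgA -s2 mulgA -s1 mulgA.
Qed.

Lemma full_twist_commuter : commute z b.
Proof.
rewrite /commute /full_twist; move: (a * b * a) swap1 swap2 => d s1 s2.
by rewrite -mulgA -s1 mulgA -s2 mulgA.
Qed.

Let full_twistE : full_twist = b * a * b * (a * b * a).
Proof. by rewrite -ab. Qed.

Lemma full_twist_baabaa : b * a * a * (b * a * a) = z.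
Proof.
have -> : b * a * a * (b * a * a) = b * a * (a * b * a) * a by rewrite !mulgA.
by rewrite {1}ab full_twistE !mulgA.
Qed.

Lemma full_twist_bbabba : b * b * a * (b * b * a) = z.
Proof.
have -> : b * b * a * (b * b * a) = b * (b * a * b) * (b * a) by rewrite !mulgA.
by rewrite -ab full_twistE !mulgA.
Qed.

Lemma conj_braid_ba : a ^ (b * a) = b.
Proof. by rewrite conjgE [a * _]mulgA ab mulKg. Qed.

Lemma conj_braid_ab : b ^ (a * b) = a.
Proof. by rewrite conjgE [b * _]mulgA -ab mulKg. Qed.

Lemma conj_braidVa : b ^ a^-1 = a ^ b.
Proof. by rewrite -{1}conj_braid_ba conjgM conjgK. Qed.

Lemma conj_braidVb : a ^ b^-1 = b ^ a.
Proof. by rewrite -{1}conj_braid_ab conjgM conjgK. Qed.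

(** Since [a ^ b] is [b ^ a^-1], the conjugates of [b] by powers of [a] form a cycle of length four
    up to conjugation by [a ^+ 4]. *)
Lemma conj_braid_baaaa : b ^ (a * a * a) = (a ^ b) ^ (a ^+ 4).
Proof.
by rewrite -conj_braidVa -[RHS]conjgM expgS mulKg !expgS expg0 mulg1 !mulgA.
Qed.

Lemma conj_braid_bbb : a ^ (b * b * b) = (b ^ a) ^ (b ^+ 4).
Proof.
by rewrite -conj_braidVb -[RHS]conjgM expgS mulKg !expgS expg0 mulg1 !mulgA.
Qed.

End BraidRelation.

(** * Homomorphisms out of B_3 and the action on six cusps *)

Section BraidHomomorphisms.
Local Open Scope group_scope.
Notation a := (sigma sg1).
Notation b := (sigma sg2).

Lemma I2_cases (i : 'I_2) : i = sg1 \/ i = sg2.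
Proof. by case: i => -[|[|//]] lti; [left|right]; apply: val_inj. Qed.

Lemma B3_ind (P : B3 -> Prop) :
  P 1 -> P a -> P b -> (forall x, P x -> P x^-1) ->
  (forall x y, P x -> P y -> P (x * y)) -> forall x, P x.
Proof.
move=> P1 Pa Pb PV PM x; have [w ->] := presented_surj x.
elim: w => [//|[i e] w IH].
rewrite -cat1s; have /= <- := presented_mulE braid_rels [:: (i, e)] w.
apply: PM => //; case: e.
  by case: (I2_cases i) => ->.
have /= <- := presented_invE braid_rels [:: (i, true)].
by apply: PV; case: (I2_cases i) => ->.
Qed.

Section Lift.
Variables (H : groupType) (x y : H).

Definition braid_map (xy : x * y * x = y * x * y) : B3 -> H :=
  @presented_lift _ braid_rels _ (fun i => if i == sg1 then x else y).

Hypothesis xy : x * y * x = y * x * y.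

Lemma braid_map_rels r : braid_rels r ->
  word_eval (fun i => if i == sg1 then x else y) r.1 =
  word_eval (fun i => if i == sg1 then x else y) r.2.
Proof.
by move=> ->; rewrite /word_eval !big_cons !big_nil /= !mulg1 !mulgA.
Qed.

HB.instance Definition _ := isUMagmaMorphism.Build B3 H (braid_map xy)
  (presented_lift_morphism braid_map_rels).

Lemma braid_map1 : braid_map xy a = x.
Proof. by rewrite /braid_map presented_lift_gen //; exact: braid_map_rels. Qed.

Lemma braid_map2 : braid_map xy b = y.
Proof. by rewrite /braid_map presented_lift_gen //; exact: braid_map_rels. Qed.

End Lift.

(* The cusps 0, ..., 5 stand for the vectors (0,1), (1,0), (1,1), (1,2), (1,3),
   (2,1) of (Z/4)^2 up to sign, on which the Burau matrices act on the right. *)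
Definition cusp_rep (j : 'I_6) : B3 :=
  tnth [tuple 1; b * a; b * a * a; b * a * a * a; b; b * b] j.

Definition cusp_act1 (j : 'I_6) : 'I_6 :=
  tnth [tuple inord 0; inord 2; inord 3; inord 4; inord 1; inord 5] j.
Definition cusp_act2 (j : 'I_6) : 'I_6 :=
  tnth [tuple inord 4; inord 1; inord 0; inord 3; inord 5; inord 2] j.

(** The cases have the form [inord k] because [tnth_inord] evaluates tables on that form. *)
Lemma I6_ind (P : 'I_6 -> Prop) :
  P (inord 0) -> P (inord 1) -> P (inord 2) -> P (inord 3) -> P (inord 4) ->
  P (inord 5) -> forall j, P j.
Proof.
move=> P0 P1 P2 P3 P4 P5 j; rewrite -(inord_val j).
by case: j => -[|[|[|[|[|[|//]]]]]] ltj.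
Qed.

Lemma tnth_inord T n (s : n.+1.-tuple T) (x0 : T) k : k < n.+1 ->
  tnth s (inord k) = nth x0 s k.
Proof. by move=> ltk; rewrite (tnth_nth x0) inordK. Qed.

Lemma cusp_act1_inj : injective cusp_act1.
Proof.
elim/I6_ind; elim/I6_ind; rewrite /cusp_act1 !(tnth_inord _ ord0) //= => /eqP;
  rewrite -val_eqE /= !inordK //.
Qed.

Lemma cusp_act2_inj : injective cusp_act2.
Proof.
elim/I6_ind; elim/I6_ind; rewrite /cusp_act2 !(tnth_inord _ ord0) //= => /eqP;
  rewrite -val_eqE /= !inordK //.
Qed.

Lemma cusp_perm_braid :
  perm cusp_act1_inj * perm cusp_act2_inj * perm cusp_act1_inj =
  perm cusp_act2_inj * perm cusp_act1_inj * perm cusp_act2_inj.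
Proof.
apply/permP; elim/I6_ind; rewrite !permM !permE /cusp_act1 /cusp_act2;
  by do 3 rewrite ?(tnth_inord _ ord0) //=.
Qed.

(** Permutations compose from left to right, so this is a right action, like conjugation [x ^ y]. *)
Definition cusp_perm : B3 -> {perm 'I_6} := braid_map cusp_perm_braid.

HB.instance Definition _ := UMagmaMorphism.on cusp_perm.

Lemma cusp_perm1 j : cusp_perm a j = cusp_act1 j.
Proof. by rewrite /cusp_perm braid_map1 permE. Qed.

Lemma cusp_perm2 j : cusp_perm b j = cusp_act2 j.
Proof. by rewrite /cusp_perm braid_map2 permE. Qed.

End BraidHomomorphisms.

(** * The conjugates of [a] attached to the cusps, and coset enumeration *)

Section CuspAction.
Local Open Scope group_scope.
Notation a := (sigma sg1).
Notation b := (sigma sg2).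
Notation z := (full_twist a b).

Lemma twist_central (x : B3) : commute z x.
Proof.
elim/B3_ind: x => [|||x|x y]; [exact: commute1|..|exact: commuteV|exact: commuteM].
- exact/full_twist_commutel/sigma_braid.
- exact/full_twist_commuter/sigma_braid.
Qed.

Lemma conj_twist (x : B3) : x ^ z = x.
Proof. by rewrite conjgE -twist_central mulKg. Qed.

(* Two of the four places where the action on the conjugates of a matches the
   action on cusps only up to a fourth power of a generator. *)
Lemma conj_bba : a ^ (b * b * a) = (a ^ (b * b)) ^ (b ^- 4).
Proof.
(* The square of [b * b * a] is the central [z], so up to [z] this element is its own inverse. *)
have -> : b * b * a = a^-1 * (b * b)^-1 * z.
  by rewrite -(full_twist_bbabba sigma_braid) -invgM mulKg.
rewrite conjgM conj_twist conjgM [a ^ a^-1]conjgE mulgV mulg1 invgK -[RHS]conjgM.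
by congr (a ^ _); rewrite !expgS expg0 mulg1 !invgM !mulgA !gnorm.
Qed.

Lemma conj_baab : (b ^ (a * a)) ^ b = (b ^ (a * a)) ^ (a ^- 4).
Proof.
rewrite -[LHS]conjgM.
have -> : a * a * b = b^-1 * z * (a * a)^-1.
  rewrite -(full_twist_baabaa sigma_braid) -!mulgA mulKg !invgM !mulgA.
  by rewrite mulgK mulgK.
rewrite conjgM conjgM conj_twist [b ^ b^-1]conjgE mulgV mulg1 invgK -[RHS]conjgM.
by congr (b ^ _); rewrite !expgS expg0 mulg1 !invgM !mulgA !gnorm.
Qed.

(** As [a] fixes the cusp 0 and [cusp_rep j] moves 0 to [j], this element fixes the cusp [j]. *)
Definition cusp (j : 'I_6) : B3 := a ^ cusp_rep j.

Definition sigmaE := (cusp_perm1, cusp_perm2).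

Lemma cusp_repE k : (k < 6)%N ->
  cusp_rep (inord k) = nth 1 [:: 1; b * a; b * a * a; b * a * a * a; b; b * b] k.
Proof. exact: tnth_inord. Qed.

Lemma cusp_act1E k : (k < 6)%N ->
  cusp_act1 (inord k) = inord (nth 0 [:: 0; 2; 3; 4; 1; 5] k)%N.
Proof.
rewrite /cusp_act1 => ltk; rewrite (tnth_inord _ ord0) //.
by case: k ltk => [|[|[|[|[|[|]]]]]].
Qed.

Lemma cusp_act2E k : (k < 6)%N ->
  cusp_act2 (inord k) = inord (nth 0 [:: 4; 1; 0; 3; 5; 2] k)%N.
Proof.
rewrite /cusp_act2 => ltk; rewrite (tnth_inord _ ord0) //.
by case: k ltk => [|[|[|[|[|[|]]]]]].
Qed.

Lemma cusp_rep_perm j : cusp_perm (cusp_rep j) (inord 0) = j.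
Proof.
elim/I6_ind: j; rewrite cusp_repE //= ?gmulf1 ?perm1 // ?gmulfM ?permM;
  by do 4 rewrite ?sigmaE ?cusp_act1E ?cusp_act2E //=.
Qed.

Lemma cuspE k : (k < 6)%N ->
  cusp (inord k) = nth 1 [:: a; b; b ^ a; b ^ (a * a); a ^ b; a ^ (b * b)] k.
Proof.
move=> ltk; rewrite /cusp cusp_repE //; have Hb := conj_braid_ba sigma_braid.
case: k ltk => [|[|[|[|[|[|//]]]]]] _ /=; rewrite ?conjg1 //.
- by rewrite conjgM Hb.
- by rewrite -mulgA conjgM Hb.
Qed.

Section Equivariance.
Variables (H : groupType) (f : UMagmaMorphism.type B3 H) (n : nat).
Hypothesis comm4 : forall i j, commute (f (cusp j ^+ n)) (f (sigma i ^+ 4)).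

(** On generators the equality holds already in B_3 except in four cases, where it is off by
    conjugation by a fourth power of a generator; [comm4] absorbs that. It is applied with [n] = 1
    when [f] kills [a ^+ 4], and with [n] = 4 in the quotient by the commutator subgroup. *)
Lemma cuspJ (x : B3) (j : 'I_6) :
  f (cusp j ^+ n) ^ f x = f (cusp (cusp_perm x j) ^+ n).
Proof.
have cJ i k : f (cusp k ^+ n) ^ f (sigma i ^+ 4) = f (cusp k ^+ n).
  by rewrite conjgE comm4 mulKg.
have cJV i k : f (cusp k ^+ n) ^ f (sigma i ^- 4) = f (cusp k ^+ n).
  by rewrite gmulfV -{1}(cJ i k) conjgK.
have E (y : B3) k l : cusp k ^ y = cusp l ->
    f (cusp k ^+ n) ^ f y = f (cusp l ^+ n).
  by rewrite -gmulfJ conjXg => ->.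
have EE (y w : B3) k l : cusp k ^ y = cusp l ^ w ->
    f (cusp k ^+ n) ^ f y = f (cusp l ^+ n) ^ f w.
  by rewrite -!gmulfJ !conjXg => ->.
elim/B3_ind: x j => [j||||].
- by rewrite !gmulf1 perm1 conjg1.
- elim/I6_ind; rewrite sigmaE cusp_act1E //=.
  + by apply: E; rewrite !cuspE //= conjgE mulKg.
  + by apply: E; rewrite !cuspE.
  + by apply: E; rewrite !cuspE //= -conjgM.
  + rewrite -[RHS](cJ sg1 (inord 4)); apply: EE; rewrite !cuspE //= -conjgM.
    exact: conj_braid_baaaa sigma_braid.
  + by apply: E; rewrite !cuspE //= -(conj_braidVa sigma_braid) conjgKV.
  rewrite -[RHS](cJV sg2 (inord 5)); apply: EE; rewrite !cuspE //= -conjgM.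
  exact: conj_bba.
- elim/I6_ind; rewrite sigmaE cusp_act2E //=.
  + by apply: E; rewrite !cuspE.
  + by apply: E; rewrite !cuspE //= conjgE mulKg.
  + by apply: E; rewrite !cuspE //= -(conj_braidVb sigma_braid) conjgKV.
  + rewrite -[RHS](cJV sg1 (inord 3)); apply: EE; rewrite !cuspE //=.
    exact: conj_baab.
  + by apply: E; rewrite !cuspE //= -conjgM.
  rewrite -[RHS](cJ sg2 (inord 2)); apply: EE; rewrite !cuspE //= -conjgM.
  exact: conj_braid_bbb sigma_braid.
- move=> x IH j; rewrite !gmulfV.
  by rewrite -{1}[j](permKV (cusp_perm x)) -IH conjgK.
by move=> x y IHx IHy j; rewrite !gmulfM conjgM IHx IHy permM.
Qed.

End Equivariance.

Section OrderFour.
Variables (H : groupType) (f : UMagmaMorphism.type B3 H).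
Hypothesis f4 : f (a ^+ 4) = 1.

Lemma sigma4_kernel i : f (sigma i ^+ 4) = 1.
Proof.
case: (I2_cases i) => -> //.
by rewrite -(conj_braid_ba sigma_braid) -conjXg gmulfJ f4 conj1g.
Qed.

(* When f a^4 = 1 the conjugates of f a are permuted exactly like the cusps, and
   the two hypotheses make the six of them distinct. *)
Lemma kernel_cusp_perm : f a * f b <> f b * f a ->
    f a * f (b * b) <> f (b * b) * f a ->
  forall x, f x = 1 -> cusp_perm x = 1.
Proof.
move=> nab nabb x fx.
have comm4 i j : commute (f (cusp j ^+ 1)) (f (sigma i ^+ 4)).
  by rewrite sigma4_kernel; exact: commute1.
have cJ := cuspJ comm4.
(* Such an equality says that [f a] commutes with [f (cusp_rep j)]. For [j] from 1 to 4 the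
   representative is b a^k, and a^k cancels; for [j] = 5 it is b^2. *)
have fix0 j : f (cusp j) = f (cusp (inord 0)) -> j = inord 0.
  rewrite [cusp (inord 0)]cuspE //= /cusp gmulfJ => /(congr1 (mulg (f (cusp_rep j)))).
  rewrite conjgE mulVKg.
  have nba k : f a * f (b * a ^+ k) <> f (b * a ^+ k) * f a.
    move=> e; apply: nab; apply: (mulIg (f (a ^+ k))).
    by rewrite -[LHS]mulgA -gmulfM e !gmulfM -!mulgA -!gmulfM -expgSr expgS.
  elim/I6_ind: j; rewrite !cusp_repE //= ?(gmulf1, mulg1, mul1g) //.
  - by move/(nba 1%N).
  - by have := nba 2%N; rewrite expgS expg1 !mulgA => ne /ne.
  - by have := nba 3%N; rewrite !expgS expg0 mulg1 !mulgA => ne /ne.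
apply/permP => j; rewrite perm1.
(* [fix0] compares with the cusp 0 only, so the equality is first conjugated back by
   [cusp_rep j]. *)
have := cJ x j; rewrite fx conjg1 => /(congr1 (conjg^~ (f (cusp_rep j)^-1))) /=.
rewrite !cJ (gmulfV cusp_perm).
have -> : (cusp_perm (cusp_rep j))^-1 j = inord 0.
  by rewrite -{2}(cusp_rep_perm j) permK.
move/esym/fix0/(congr1 (cusp_perm (cusp_rep j))); rewrite permKV.
by rewrite cusp_rep_perm.
Qed.

Hypothesis fz : f z = 1.

(** Coset enumeration over the powers of [a]: twelve products of a representative with a generator
    are reduced by a^4 = b^4 = 1, (baa)^2 = (bba)^2 = 1 and the braid relation. *)
Lemma coset_rep (x : B3) (j : 'I_6) :
  exists k, f (cusp_rep j * x) = f (a ^+ k * cusp_rep (cusp_perm x j)).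
Proof.
have fb4 : f (b ^+ 4) = 1 := sigma4_kernel sg2.
have AAAA : f a * (f a * (f a * f a)) = 1.
  by rewrite -!gmulfM -[RHS]f4 !expgS expg0 mulg1.
have BBBB : f b * (f b * (f b * f b)) = 1.
  by rewrite -!gmulfM -[RHS]fb4 !expgS expg0 mulg1.
have AV : (f a)^-1 = f a * f a * f a by apply: mulg1_eq; rewrite !mulgA in AAAA *.
have AV2 : (f a)^-1 * (f a)^-1 = f a * f a.
  by rewrite -invgM; apply: mulg1_eq; rewrite !mulgA in AAAA *.
have BV : (f b)^-1 = f b * f b * f b by apply: mulg1_eq; rewrite !mulgA in BBBB *.
have BV2 : (f b)^-1 * (f b)^-1 = f b * f b.
  by rewrite -invgM; apply: mulg1_eq; rewrite !mulgA in BBBB *.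
have BAA : f b * f a * f a = f a * f a * (f b)^-1.
  rewrite -AV2 -mulgA -!invgM; apply/esym/mulg1_eq.
  by rewrite -[RHS]fz -(full_twist_baabaa sigma_braid) !gmulfM !mulgA.
have BBA : f b * f b * f a = f a * f a * f a * (f b * f b).
  rewrite -AV -[X in _ = _ * X]BV2 -!invgM; apply/esym/mulg1_eq.
  by rewrite -[RHS]fz -(full_twist_bbabba sigma_braid) !gmulfM !mulgA.
elim/B3_ind: x j => [j||||].
- by exists 0%N; rewrite gmulf1 perm1 mulg1 mul1g.
- elim/I6_ind; rewrite sigmaE cusp_act1E // !cusp_repE //=.
  + by exists 1%N; rewrite mulg1 mul1g.
  + by exists 0%N; rewrite mul1g.
  + by exists 0%N; rewrite mul1g.
  + exists 0%N; rewrite mul1g -!mulgA gmulfM.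
    by have := f4; rewrite !expgS expg0 mulg1 => ->; rewrite mulg1.
  + by exists 0%N; rewrite mul1g.
  by exists 3%N; rewrite !expgS expg0 mulg1 !gmulfM BBA !mulgA.
- elim/I6_ind; rewrite sigmaE cusp_act2E // !cusp_repE //=.
  + by exists 0%N; rewrite mul1g.
  + by exists 1%N; rewrite expg1 -sigma_braid !mulgA.
  + by exists 2; rewrite mulg1 !gmulfM BAA mulgVK.
  (* The cusp 3 is fixed by [b]: since b a b^-1 = a^-1 b a, the product b a^3 b becomes a^-1 b a^3,
     and a^-1 is a^3. *)
  + exists 3; rewrite !expgS expg0 mulg1 !gmulfM !mulgA.
    have -> : f b * f a * f a * f a * f b =
        f b * f a * ((f b)^-1 * (f b * f a * f a) * f b).
      by rewrite !mulgA mulgVK.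
    have BAV : f b * f a * (f b)^-1 = (f a)^-1 * f b * f a.
      apply: (mulIg (f b)); rewrite mulgVK -!mulgA; apply: (mulgI (f a)).
      by rewrite mulVKg !mulgA -!gmulfM sigma_braid.
    by rewrite BAA -[X in _ * X = _]mulgA mulgVK !mulgA BAV AV.
  + by exists 0%N; rewrite mul1g.
  exists 2; rewrite expgS expg1 !gmulfM BAA BV !mulgA in AAAA *.
  by rewrite AAAA mul1g.
- move=> x IH j.
  have [k e] := IH ((cusp_perm x)^-1 j).
  (* The exponent [3 * k] stands for -k, as the fourth power of [f a] is trivial. *)
  exists (3 * k)%N; rewrite gmulfV.
  rewrite permKV in e.
  apply: (mulIg (f x)); rewrite -gmulfM mulgVK.
  have ak : f (a ^+ k) * f (a ^+ (3 * k)) = 1.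
    by rewrite -gmulfM -expgnDr -mulSn expgnA gmulfXn f4 expg1n.
  apply: (mulgI (f (a ^+ k))).
  by rewrite -gmulfM -e !gmulfM !mulgA ak mul1g.
move=> x y IHx IHy j.
have [k e] := IHx j; have [l e'] := IHy (cusp_perm x j).
exists (k + l)%N; rewrite mulgA gmulfM e gmulfM -mulgA -gmulfM e' -gmulfM.
by rewrite [cusp_perm (x * y)]gmulfM permM expgnDr !mulgA.
Qed.

End OrderFour.
End CuspAction.

(** * The kernel of the cusp action and the quotient S_4 *)

Section CuspKernel.
Local Open Scope group_scope.
Notation a := (sigma sg1).
Notation b := (sigma sg2).
Notation z := (full_twist a b).

(** [a] rotates the cusps 1, 2, 3, 4, so the image of the cusp 1 detects the exponent modulo 4. *)
Lemma cusp_perm_sigmaX k : cusp_perm (a ^+ k) (inord 1) = inord (k %% 4).+1.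
Proof.
elim: k => [|k IH]; first by rewrite gmulf1 perm1.
rewrite expgSr gmulfM permM IH sigmaE.
have -> : k.+1 %% 4 = (k %% 4).+1 %% 4 by rewrite -addn1 -modnDml addn1.
move: (ltn_pmod k (isT : 0 < 4)%N).
by case: (k %% 4)%N => [|[|[|[|//]]]] _; rewrite cusp_act1E.
Qed.

Lemma cusp_perm_sigmaX_inj k l :
  cusp_perm (a ^+ k) = cusp_perm (a ^+ l) -> k = l %[mod 4].
Proof.
move=> /permP/(_ (inord 1)); rewrite !cusp_perm_sigmaX => /(congr1 val) /=.
have lt4 m : ((m %% 4).+1 < 6)%N.
  by rewrite ltnS (leq_trans (ltn_pmod m (isT : 0 < 4)%N)).
by rewrite !inordK // => -[].
Qed.

(* A word is equal to some a^k h_j in the image of f; if it fixes all cusps then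
   j = 0 and 4 divides k. *)
Lemma cusp_perm_kernel (H : groupType) (f : UMagmaMorphism.type B3 H) :
    f (a ^+ 4) = 1 -> f z = 1 -> (forall x, f x = 1 -> cusp_perm x = 1) ->
  forall x, cusp_perm x = 1 -> f x = 1.
Proof.
move=> f4 fz fpi x xpi; have [k] := coset_rep f4 fz x (inord 0).
rewrite xpi perm1 cusp_repE //= mul1g mulg1 => fx.
have : f (x * a ^- k) = 1 by rewrite gmulfM fx -gmulfM mulgV gmulf1.
move=> /fpi/eqP; rewrite gmulfM gmulfV /= xpi mul1g invg_eq1 => /eqP pik.
have /eqP : k = 0 %[mod 4] by apply: cusp_perm_sigmaX_inj; rewrite pik gmulf1.
by rewrite mod0n => /dvdnP[q kq]; rewrite fx kq mulnC expgnA gmulfXn f4 expg1n.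
Qed.

Lemma rho4_sigma4 : rho4 (a ^+ 4) = 1.
Proof.
apply: val_inj; rewrite !expgS expg0 mulg1 !gmulfM /= rho4_sigma.
apply/matrixP => i j; rewrite !mxE !big_ord_recl !big_ord0 !mxE.
rewrite !big_ord_recl !big_ord0 !mxE !big_ord_recl !big_ord0 !mxE.
by case: i => -[|[|//]] ?; case: j => -[|[|//]] ?; apply/val_inj.
Qed.

(** For the Burau matrices A and B the upper left entries separate AB from BA (0 and 1) and AB^2
    from B^2A (-1 and 1 modulo 4). *)
Lemma rho4_kernel x : rho4 x = 1 -> cusp_perm x = 1.
Proof.
apply: kernel_cusp_perm; first exact: rho4_sigma4.
  move=> /(congr1 (fun A : SL 2 'Z_4 => fun_of_matrix (\val A) ord0 ord0))/eqP.
  by rewrite /= !rho4_sigma !mxE !big_ord_recl !big_ord0 !mxE.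
move=> /(congr1 (fun A : SL 2 'Z_4 => fun_of_matrix (\val A) ord0 ord0))/eqP.
rewrite gmulfM /= !rho4_sigma !mxE !big_ord_recl !big_ord0 !mxE.
by rewrite !big_ord_recl !big_ord0 !mxE.
Qed.

(* The 4-cycles (0 1 2 3) and (0 1 3 2). *)
Definition diag_act1 (j : 'I_4) : 'I_4 :=
  tnth [tuple inord 1; inord 2; inord 3; inord 0] j.
Definition diag_act2 (j : 'I_4) : 'I_4 :=
  tnth [tuple inord 1; inord 3; inord 0; inord 2] j.

Lemma I4_ind (P : 'I_4 -> Prop) :
  P (inord 0) -> P (inord 1) -> P (inord 2) -> P (inord 3) -> forall j, P j.
Proof.
move=> P0 P1 P2 P3 j; rewrite -(inord_val j).
by case: j => -[|[|[|[|//]]]] ltj.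
Qed.

Lemma diag_act1_inj : injective diag_act1.
Proof.
elim/I4_ind; elim/I4_ind; rewrite /diag_act1 !(tnth_inord _ ord0) //= => /eqP;
  rewrite -val_eqE /= !inordK //.
Qed.

Lemma diag_act2_inj : injective diag_act2.
Proof.
elim/I4_ind; elim/I4_ind; rewrite /diag_act2 !(tnth_inord _ ord0) //= => /eqP;
  rewrite -val_eqE /= !inordK //.
Qed.

Lemma diag_perm_braid :
  perm diag_act1_inj * perm diag_act2_inj * perm diag_act1_inj =
  perm diag_act2_inj * perm diag_act1_inj * perm diag_act2_inj.
Proof.
apply/permP; elim/I4_ind; rewrite !permM !permE /diag_act1 /diag_act2;
  by do 3 rewrite ?(tnth_inord _ ord0) //=.
Qed.

(** The cusps behave like the faces of a cube, on which [a] and [b] act as quarter turns about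
    perpendicular axes; the four points behave like its space diagonals. *)
Definition diag_perm : B3 -> 'S_4 := braid_map diag_perm_braid.

HB.instance Definition _ := UMagmaMorphism.on diag_perm.

Lemma diag_perm1 : diag_perm a = perm diag_act1_inj.
Proof. exact: braid_map1. Qed.

Lemma diag_perm2 : diag_perm b = perm diag_act2_inj.
Proof. exact: braid_map2. Qed.

Lemma diag_perm_sigma4 : diag_perm (a ^+ 4) = 1.
Proof.
rewrite !expgS expg0 mulg1 !gmulfM /= diag_perm1.
apply/permP; elim/I4_ind; rewrite !permM !permE /diag_act1;
  by do 4 rewrite ?(tnth_inord _ ord0) //=.
Qed.

Lemma diag_perm_twist : diag_perm z = 1.
Proof.
rewrite !gmulfM /= diag_perm1 diag_perm2.
apply/permP; elim/I4_ind; rewrite !permM !permE /diag_act1 /diag_act2;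
  by do 6 rewrite ?(tnth_inord _ ord0) //=.
Qed.

(** [diag_perm] kills [a ^+ 4] and [z], and its values on the generators satisfy both noncommutation
    conditions, so the two general kernel criteria apply. *)
Lemma diag_perm_kernel x : diag_perm x = 1 <-> cusp_perm x = 1.
Proof.
have H : forall x, diag_perm x = 1 -> cusp_perm x = 1.
  apply: kernel_cusp_perm; first exact: diag_perm_sigma4.
    move=> /permP/(_ (inord 0)); rewrite !permM /= diag_perm1 diag_perm2 !permE.
    rewrite /diag_act1 /diag_act2; do 2 rewrite ?(tnth_inord _ ord0) //=.
    by move/(congr1 val); rewrite /= !inordK.
  move=> /permP/(_ (inord 0)); rewrite !gmulfM !permM /= diag_perm1 diag_perm2 !permE.
  rewrite /diag_act1 /diag_act2; do 3 rewrite ?(tnth_inord _ ord0) //=.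
  by move/(congr1 val); rewrite /= !inordK.
split; first exact: H.
apply: cusp_perm_kernel x => //; [exact: diag_perm_sigma4|exact: diag_perm_twist].
Qed.

(** By counting: the 4 * 6 elements a^k h_j have distinct images, because the image of the cusp 0
    gives [j] and then that of the cusp 1 gives [k]; and 4! = 24. *)
Lemma diag_perm_surj (s : 'S_4) : exists x, diag_perm x = s.
Proof.
pose rep (u : 'I_4 * 'I_6) : B3 := a ^+ u.1 * cusp_rep u.2.
have rep_inj : injective (diag_perm \o rep).
  have piE x y : diag_perm x = diag_perm y -> cusp_perm x = cusp_perm y.
    move=> e; apply/(mulIg (cusp_perm y)^-1)/esym; rewrite mulgV -gmulfF.
    by apply/esym/diag_perm_kernel; rewrite gmulfF /= e mulgV.
  move=> [k j] [l i] /piE; rewrite /rep /= => e.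
  have pia (m : nat) : cusp_perm (a ^+ m) (inord 0) = inord 0.
    elim: m => [|m IH]; first by rewrite gmulf1 perm1.
    by rewrite expgSr gmulfM permM IH sigmaE cusp_act1E.
  have eij : j = i.
    have /permP/(_ (inord 0)) := e.
    by rewrite !gmulfM !permM /= !pia !cusp_rep_perm.
  rewrite eij in e *; congr (_, _); apply: val_inj.
  move: e; rewrite !gmulfM => /mulIg/cusp_perm_sigmaX_inj.
  by rewrite !modn_small.
have card : #|{: 'I_4 * 'I_6}| = #|{: 'S_4}|.
  by rewrite card_prod !card_ord card_Sn.
have /codomP[u ->] := inj_card_onto rep_inj (eq_leq (esym card)) s.
by exists (rep u).
Qed.

End CuspKernel.

(** * Quotient maps and factorization through them *)

Section QuotientMap.
Local Open Scope group_scope.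
Local Open Scope quotient_scope.
Variables (G : groupType) (N : normalClosed G).

Definition quotient_map (x : G) : quotient_group N := \pi_(quotient_group N) x.

Lemma quotient_map_morphism : monoid.monoid_morphism quotient_map.
Proof. by split=> // x y; rewrite [RHS]quotient_mulE. Qed.

HB.instance Definition _ :=
  isUMagmaMorphism.Build G (quotient_group N) quotient_map quotient_map_morphism.

Lemma quotient_map_eq1 x : (quotient_map x == 1) = (x \in N).
Proof.
apply/eqP/idP => [e|Nx].
  have /quotient_eqP : \pi_(quotient_group N) 1 = \pi_(quotient_group N) x by [].
  by rewrite invg1 mul1g.
by apply/esym/quotient_eqP; rewrite invg1 mul1g.
Qed.

Lemma quotient_map_surj u : exists x, u = quotient_map x.
Proof. exact: quotient_surj. Qed.

Section Factor.
Variables (H : groupType) (f : UMagmaMorphism.type G H).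

Definition quotient_factor (fN : forall x, x \in N -> f x = 1)
  (u : quotient_group N) : H := f (generic_quotient.repr u).

Hypothesis fN : forall x, x \in N -> f x = 1.

Lemma quotient_factorE x : quotient_factor fN (quotient_map x) = f x.
Proof.
rewrite /quotient_factor.
have /quotient_eqP/fN :
    generic_quotient.repr (quotient_map x) = x %[mod quotient_group N].
  by rewrite reprK.
by rewrite gmulfM gmulfV => /mulg1_eq; rewrite invgK.
Qed.

Lemma quotient_factor_morphism : monoid.monoid_morphism (quotient_factor fN).
Proof.
have q1 : quotient_map 1 = 1 := gmulf1.
split=> [|u v]; first by rewrite -q1 quotient_factorE gmulf1.
have [x ->] := quotient_map_surj u; have [y ->] := quotient_map_surj v.
by rewrite -gmulfM !quotient_factorE gmulfM.
Qed.

HB.instance Definition _ :=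
  isUMagmaMorphism.Build (quotient_group N) H (quotient_factor fN)
    quotient_factor_morphism.

End Factor.

Lemma quotient_map_commute x y :
  [~ x, y] \in N -> commute (quotient_map x) (quotient_map y).
Proof. by rewrite -quotient_map_eq1 gmulfR => /eqP/eqP/commgP. Qed.

End QuotientMap.

(** * Integer powers in a group *)

Section IntegerPowers.
Local Open Scope group_scope.
Variable G : groupType.
Implicit Types (x y : G) (m n : int).

Definition expgz x m : G := match m with Posz n => x ^+ n | Negz n => x ^- n.+1 end.

Lemma expgz0 x : expgz x 0%R = 1. Proof. by []. Qed.

Lemma expgzN x m : expgz x (- m)%R = (expgz x m)^-1.
Proof. by case: m => [[|n]|n] /=; rewrite ?invg1 ?invgK. Qed.

Lemma expgzB_nat x (m n : nat) : expgz x (m%:Z - n%:Z)%R = x ^+ m / x ^+ n.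
Proof.
case: (leqP n m) => [nm|mn].
  by rewrite subzn //= expgnFr.
rewrite -[(_ - _)%R]GRing.opprB expgzN subzn 1?ltnW //=.
by rewrite expgnFr ?invgF // ltnW.
Qed.

Lemma expgzD x m n : expgz x (m + n)%R = expgz x m * expgz x n.
Proof.
have xx k l : commute (x ^+ k) (x ^+ l) by apply/commuteX2/commute_refl.
case: m n => [m|m] [n|n].
- exact: expgnDr.
- by rewrite NegzE expgzB_nat.
- by rewrite GRing.addrC NegzE expgzB_nat /=; apply/commuteV/xx.
rewrite !NegzE -GRing.opprD -PoszD !expgzN /expgz expgnDr invgM.
exact/commute_sym/commuteV/commute_sym/commuteV/xx.
Qed.

Lemma commute_expgz x y m : commute x y -> commute x (expgz y m).
Proof. by move=> xy; case: m => n /=; [apply: commuteX|apply/commuteV/commuteX]. Qed.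

End IntegerPowers.

Lemma gmulf_expgz (G H : groupType) (f : UMagmaMorphism.type G H) (x : G) m :
  f (expgz x m) = expgz (f x) m.
Proof. by case: m => n /=; rewrite ?gmulfV gmulfXn. Qed.

(** * The abelian subgroup generated by z and the c_j in the quotient *)

Section CuspLattice.
Local Open Scope group_scope.
Notation a := (sigma sg1).
Notation b := (sigma sg2).
Notation z := (full_twist a b).
Definition B3_4' : normalClosed B3 := gcomm B3_4 B3_4.
Notation Q := (quotient_group B3_4').

Notation proj := (quotient_map B3_4').

Lemma proj_surj (u : Q) : exists x, u = proj x.
Proof. exact: quotient_map_surj. Qed.

Lemma projM x y : proj (x * y) = proj x * proj y. Proof. exact: gmulfM. Qed.
Lemma projV x : proj x^-1 = (proj x)^-1. Proof. exact: gmulfV. Qed.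
Lemma projX x n : proj (x ^+ n) = proj x ^+ n. Proof. exact: gmulfXn. Qed.

Lemma gcomm_kernel (H : groupType) (f : UMagmaMorphism.type B3 H) :
    (forall x y, x \in B3_4 -> y \in B3_4 -> commute (f x) (f y)) ->
  forall x, x \in B3_4' -> f x = 1.
Proof.
move=> fK x /asboolP/(_ (gker f)) xf; apply/eqP/xf => _ [u [v [Ku Kv ->]]].
by rewrite inE gmulfR; apply/commgP/fK.
Qed.

Lemma cusp4_B3_4 j : cusp j ^+ 4 \in B3_4.
Proof.
by rewrite /cusp -conjXg; apply: gpredJr; rewrite inE; apply/eqP/rho4_sigma4.
Qed.

Definition cusp4 j : Q := proj (cusp j ^+ 4).

Lemma proj_B3_4_commute x y : x \in B3_4 -> y \in B3_4 -> commute (proj x) (proj y).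
Proof. by move=> Kx Ky; apply/quotient_map_commute/sub_ggen; exists x, y. Qed.

Lemma cusp4_commute i j : commute (cusp4 i) (cusp4 j).
Proof. by apply: proj_B3_4_commute; exact: cusp4_B3_4. Qed.

Lemma cusp4J x j : cusp4 j ^ proj x = cusp4 (cusp_perm x j).
Proof.
apply: cuspJ => i k; apply: proj_B3_4_commute; first exact: cusp4_B3_4.
(* Each generator is itself the element of the cusp 0 or 1, so its fourth power also lies in
   B_3[4]. *)
have -> : sigma i = cusp (inord (if i == sg1 then 0 else 1)%N).
  by case: (I2_cases i) => ->; rewrite ?eqxx cuspE.
exact: cusp4_B3_4.
Qed.

Definition twist : Q := proj z.

Lemma twist_commute u : commute twist u.
Proof. by have [x ->] := proj_surj u; exact/gmulf_commute/twist_central. Qed.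

(* Since a b^4 = z (a^-1)^(b b), the product of the four conjugates of b^4 by
   powers of a is a^-4 (a b^4)^4 = a^-4 z^4 (a^-4)^(b b). *)
Lemma prod_cusp4 : \prod_(j < 6) cusp4 j = twist ^+ 4.
Proof.
have E : cusp4 (inord 4) * cusp4 (inord 3) * (cusp4 (inord 2) * cusp4 (inord 1)) =
    (cusp4 (inord 0))^-1 * twist ^+ 4 * (cusp4 (inord 5))^-1.
  have cX k : (k < 4)%N -> cusp4 (inord k.+1) = proj ((b ^+ 4) ^ (a ^+ k)).
    move=> ltk; rewrite gmulfJ /=; have <- : cusp4 (inord 1) = proj (b ^+ 4).
      by rewrite /cusp4 cuspE.
    by rewrite cusp4J cusp_perm_sigmaX modn_small.
  have ab4 : a * b ^+ 4 = z * (a^-1) ^ (b * b).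
    have e : b * b * a * (b * b) = z * a^-1.
      by rewrite -(full_twist_bbabba sigma_braid) [in RHS]mulgA mulgK.
    apply: (mulgI (b * b)); rewrite [RHS]mulgA -twist_central -[RHS]mulgA conjgE mulVKg.
    by rewrite [RHS]mulgA -e !expgS expg0 mulg1 !mulgA.
  have tele (x y : B3) : y ^ (x ^+ 3) * y ^ (x ^+ 2) * (y ^ (x ^+ 1) * y ^ (x ^+ 0)) =
      (x ^+ 4)^-1 * (x * y) ^+ 4.
    by rewrite !expgS !expg0 !mulg1 !conjgE !invgM !mulgA !gnorm.
  rewrite (cX 3) // (cX 2) // (cX 1%N) // (cX 0%N) //.
  rewrite -(projM (_ ^ (a ^+ 3))) -(projM (_ ^ (a ^+ 1))) -projM tele ab4.
  rewrite expgMn; last exact: twist_central.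
  by rewrite conjVg expVgn 2!projM !projV !projX /cusp4 !cuspE //= !projX mulgA.
have split6 (F : 'I_6 -> Q) : \prod_(j < 6) F j =
    F (inord 0) * (F (inord 1) * F (inord 2) * (F (inord 3) * F (inord 4))) *
    F (inord 5).
  rewrite !big_ord_recl big_ord0 mulg1 !mulgA.
  by congr (F _ * F _ * F _ * F _ * F _ * F _); apply: val_inj; rewrite /= inordK.
rewrite split6; set w := (X in _ * X * _).
have -> : w = (cusp4 (inord 0))^-1 * twist ^+ 4 * (cusp4 (inord 5))^-1.
  rewrite -E [cusp4 (inord 4) * _]cusp4_commute [cusp4 (inord 2) * _]cusp4_commute.
  by apply: commuteM; apply/commute_sym/commuteM; exact: cusp4_commute.
by rewrite -[X in _ * X * _]mulgA mulVKg mulgVK.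
Qed.

Definition lattice_elt (u : 'I_6 -> int) (m : int) : Q :=
  \prod_(j < 6) expgz (cusp4 j) (u j) * expgz twist m.

Lemma lattice_eltD u v m n :
  lattice_elt u m * lattice_elt v n =
  lattice_elt (fun j => u j + v j)%R (m + n)%R.
Proof.
rewrite /lattice_elt expgzD; under [X in _ = X * _]eq_bigr do rewrite expgzD.
rewrite prodgM_commute => [|i j _ _]; last first.
  by apply/commute_expgz/commute_sym/commute_expgz/cusp4_commute.
rewrite -!mulgA; congr (_ * _); rewrite !mulgA; congr (_ * _).
exact/commute_sym/commute_expgz/commute_sym/twist_commute.
Qed.

Lemma lattice_elt0 : lattice_elt (fun=> 0%R) 0%R = 1.
Proof. by rewrite /lattice_elt big1 ?mulg1. Qed.

Lemma lattice_eltN u m : lattice_elt (fun j => - u j)%R (- m)%R = (lattice_elt u m)^-1.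
Proof.
apply/esym/mulg1_eq; rewrite lattice_eltD GRing.subrr -lattice_elt0.
by congr lattice_elt; apply/funext => j; rewrite GRing.subrr.
Qed.

Lemma lattice_elt_cusp4 j : lattice_elt (fun i => Posz (i == j)) 0%R = cusp4 j.
Proof.
rewrite /lattice_elt expgz0 mulg1 -[RHS](big_pred1_eq mulg j) big_mkcond.
by apply: eq_bigr => i _; rewrite /=; case: eqP.
Qed.

Lemma lattice_elt_twist : lattice_elt (fun=> 0%R) 1%R = twist.
Proof. by rewrite /lattice_elt big1 ?mul1g. Qed.

(** These are the powers of the relation [prod_cusp4]. *)
Lemma lattice_elt_const (n : int) : lattice_elt (fun=> n) (- (4%:Z * n))%R = 1.
Proof.
have E1 : lattice_elt (fun=> 1%R) (- 4%:Z)%R = 1.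
  by rewrite /lattice_elt /expgz /= prod_cusp4 mulgV.
have Enat (k : nat) : lattice_elt (fun=> Posz k) (- (4%:Z * k%:Z))%R = 1.
  elim: k => [|k IH]; first by rewrite GRing.mulr0 GRing.oppr0 lattice_elt0.
  rewrite -(mulg1 1) -{1}E1 -IH lattice_eltD; congr (lattice_elt _ _).
  by rewrite -[k.+1]add1n PoszD GRing.mulrDr GRing.mulr1 GRing.opprD.
case: n => k; first exact: Enat.
rewrite NegzE GRing.mulrN -[RHS]invg1 -(Enat k.+1).
by rewrite -[RHS]lattice_eltN.
Qed.

Definition lattice : {pred Q} := fun x => `[< exists u m, x = lattice_elt u m >].

Lemma lattice_mulg_closed : mulg_closed lattice.
Proof.
move=> _ _ /asboolP[u [m ->]] /asboolP[v [n ->]]; apply/asboolP.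
by rewrite lattice_eltD; eexists _, _.
Qed.

Lemma lattice1 : 1 \in lattice.
Proof. by apply/asboolP; rewrite -lattice_elt0; eexists _, _. Qed.

Lemma lattice_invg_closed : invg_closed lattice.
Proof.
by move=> _ /asboolP[u [m ->]]; apply/asboolP; rewrite -lattice_eltN; eexists _, _.
Qed.

HB.instance Definition _ := isMulClosed.Build Q lattice lattice_mulg_closed.
HB.instance Definition _ := isMul1Closed.Build Q lattice lattice1.
HB.instance Definition _ := isInvClosed.Build Q lattice lattice_invg_closed.

Let gens : set Q := [set y | (exists j, y = cusp4 j) \/ y = twist].

Let gensJ y v : gens y -> gens (y ^ v).
Proof.
have [x ->] := proj_surj v; case=> [[j ->]|->]; [left|right].
  by rewrite cusp4J; eexists.
by rewrite conjgE twist_commute mulKg.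
Qed.

(** Given by generators, because a generating set stable under conjugation yields normality at
    once. *)
Let gen_lattice : {pred Q} := ggen gens.
HB.instance Definition _ := GroupClosed.on gen_lattice.
HB.instance Definition _ := isConjClosed.Build Q gen_lattice (ggenJ gensJ).

Lemma B3_4'_cusp_perm x : x \in B3_4' -> cusp_perm x = 1.
Proof.
apply: gcomm_kernel => u v /eqP/rho4_kernel pu /eqP/rho4_kernel pv.
by rewrite /commute /= pu pv.
Qed.

Lemma cusp_perm_cusp4 j : cusp_perm (cusp j ^+ 4) = 1.
Proof. exact/rho4_kernel/eqP/cusp4_B3_4. Qed.

Lemma cusp_perm_twist : cusp_perm z = 1.
Proof. exact/diag_perm_kernel/diag_perm_twist. Qed.

(** Modulo [gen_lattice] both [a ^+ 4] and [z] vanish, so [cusp_perm_kernel] applies to the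
    composite of the two quotient maps. *)
Lemma kernel_lattice x : cusp_perm x = 1 -> exists u m, proj x = lattice_elt u m.
Proof.
move=> px; apply/asboolP; rewrite -[X in is_true X]/(proj x \in lattice).
suff : proj x \in gen_lattice.
  move/asboolP; apply => y [[j ->]|->]; apply/asboolP.
    by rewrite -lattice_elt_cusp4; eexists _, _.
  by rewrite -lattice_elt_twist; eexists _, _.
rewrite -quotient_map_eq1.
pose f : UMagmaMorphism.type B3 _ := quotient_map gen_lattice \o quotient_map B3_4'.
apply/eqP; apply: (cusp_perm_kernel (f := f)) px.
- apply/eqP; rewrite /= quotient_map_eq1; apply: sub_ggen; left.
  by exists (inord 0); rewrite /cusp4 cuspE.
- by apply/eqP; rewrite /= quotient_map_eq1; apply: sub_ggen; right.
(* [cusp_perm] factors through [Q] and kills the generators, hence all of [gen_lattice]. *)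
move=> y /eqP; rewrite /= quotient_map_eq1 => /asboolP.
move/(_ (gker (quotient_factor B3_4'_cusp_perm))) => H.
rewrite -(quotient_factorE B3_4'_cusp_perm); apply/eqP/H => w [[j ->]|->].
  by apply/eqP; apply: etrans (quotient_factorE _ _) _; exact: cusp_perm_cusp4.
by apply/eqP; apply: etrans (quotient_factorE _ _) _; exact: cusp_perm_twist.
Qed.

End CuspLattice.

(** * Isometries whose linear part is a permutation matrix *)

Section PermIsometries.
Import GRing.Theory Num.Theory.
Local Open Scope ring_scope.
Variables (R : realType) (d : nat).

Lemma perm_mx_orth (s : 'S_d) : (perm_mx s : 'M[R]_d) *m (perm_mx s)^T == 1%:M.
Proof. by rewrite tr_perm_mx -perm_mxM mulgV perm_mx1. Qed.

(** [perm_mx s] sends a column w to the column with entries w (s i), which agrees with composing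
    permutations from left to right. *)
Definition perm_isom (v : 'I_d -> R) (s : 'S_d) : euclid R d :=
  (\col_i v i, exist _ (perm_mx s) (perm_mx_orth s)).

Lemma perm_isomE v s w t : (forall i, v i = w i) -> s = t ->
  perm_isom v s = perm_isom w t.
Proof.
by move=> vw ->; congr (_, _); apply/colP => i; rewrite !mxE.
Qed.

Lemma perm_isom_inj v s w t :
  perm_isom v s = perm_isom w t -> (forall i, v i = w i) /\ s = t.
Proof.
move=> [vw st]; split=> [i|].
  by have /colP/(_ i) := vw; rewrite !mxE.
apply/permP => i; have /matrixP/(_ i (s i)) := st.
rewrite !mxE eqxx; case: eqP => [-> //|_] /eqP.
by rewrite oner_eq0.
Qed.

Lemma perm_isomM v s w t : (perm_isom v s * perm_isom w t)%g =
  perm_isom (fun i => v i + w (s i)) (s * t)%g.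
Proof.
congr (_, _).
  by apply/colP => i; rewrite /= -row_permE !mxE.
by apply: val_inj; rewrite /= perm_mxM.
Qed.

Lemma perm_isom1 : perm_isom (fun=> 0) 1%g = 1%g.
Proof.
congr (_, _); first by apply/colP => i; rewrite !mxE.
by apply: val_inj; rewrite /= perm_mx1.
Qed.

Lemma perm_isomV v s :
  ((perm_isom v s)^-1)%g = perm_isom (fun i => - v (s^-1%g i)) s^-1%g.
Proof.
apply: mulg1_eq; rewrite perm_isomM -perm_isom1; apply: perm_isomE.
  by move=> i; rewrite permK subrr.
by rewrite mulgV.
Qed.

Lemma perm_isomJ t v s : (perm_isom t 1 ^ perm_isom v s)%g =
  perm_isom (fun i => t (s^-1%g i)) 1%g.
Proof.
apply: (mulgI (perm_isom v s)); rewrite conjgE mulVKg !perm_isomM.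
apply: perm_isomE; last by rewrite mulg1 mul1g.
by move=> i; rewrite permK perm1 addrC.
Qed.

Lemma translationX t n : expgz (perm_isom t 1) n = perm_isom (fun i => t i *~ n) 1.
Proof.
have X k : (perm_isom t 1 ^+ k)%g = perm_isom (fun i => t i *+ k) 1.
  elim: k => [|k IH]; first by rewrite expg0 -perm_isom1; apply: perm_isomE.
  rewrite expgS IH perm_isomM; apply: perm_isomE; last by rewrite mul1g.
  by move=> i; rewrite perm1 mulrS.
case: n => k /=; first exact: X.
rewrite X perm_isomV; apply: perm_isomE; last by rewrite invg1.
by move=> i; rewrite invg1 perm1 NegzE mulrNz.
Qed.

Lemma translation_prod (I : Type) (r : seq I) (t : I -> 'I_d -> R) :
  (\prod_(k <- r) perm_isom (t k) 1)%g = perm_isom (fun i => \sum_(k <- r) t k i) 1.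
Proof.
elim: r => [|k r IH].
  by rewrite big_nil -perm_isom1; apply: perm_isomE => // i; rewrite big_nil.
rewrite big_cons IH perm_isomM; apply: perm_isomE; last by rewrite mul1g.
by move=> i; rewrite big_cons perm1.
Qed.

End PermIsometries.

(** * The isometric action of B_3 on R^6 and its faithfulness *)

Section EuclideanBraid.
Import GRing.Theory Num.Theory.
Local Open Scope ring_scope.
Variable R : realType.
Notation a := (sigma sg1).
Notation b := (sigma sg2).
Notation z := (full_twist a b).

(* These translation parts solve the linear system that expresses the braid
   relation, c_j = 4 e_j and z = (1, ..., 1). *)
Definition shift1 (i : 'I_6) : R := tnth [tuple 1; 0; 0; 0; 0; 0] i.
Definition shift2 (i : 'I_6) : R := tnth [tuple -1; 1; 0; 0; 1; 0] i.

Lemma isom_braid :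
  let x := perm_isom shift1 (perm cusp_act1_inj) in
  let y := perm_isom shift2 (perm cusp_act2_inj) in
  (x * y * x = y * x * y)%g.
Proof.
rewrite /= !perm_isomM; apply: perm_isomE; last exact: cusp_perm_braid.
elim/I6_ind; rewrite !permM !permE;
  by do 3 rewrite ?cusp_act1E ?cusp_act2E //=;
     rewrite /shift1 /shift2 !(tnth_inord _ 0) //=; ring.
Qed.

Definition isom : B3 -> euclid R 6 := braid_map isom_braid.
HB.instance Definition _ := UMagmaMorphism.on isom.

Lemma isom1 : isom a = perm_isom shift1 (cusp_perm a).
Proof. by rewrite /isom /cusp_perm !braid_map1. Qed.

Lemma isom2 : isom b = perm_isom shift2 (cusp_perm b).
Proof. by rewrite /isom /cusp_perm !braid_map2. Qed.

(** Integrality of the translation parts later gives discreteness. *)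
Lemma isomE x : exists u : 'I_6 -> int,
  isom x = perm_isom (fun i => (u i)%:~R) (cusp_perm x).
Proof.
elim/B3_ind: x.
- exists (fun=> 0); rewrite !gmulf1 -perm_isom1; exact: perm_isomE.
- exists (fun i => tnth [tuple 1; 0; 0; 0; 0; 0] i); rewrite isom1.
  apply: perm_isomE => //; elim/I6_ind; by rewrite /shift1 !(tnth_inord _ 0).
- exists (fun i => tnth [tuple -1; 1; 0; 0; 1; 0] i); rewrite isom2.
  apply: perm_isomE => //; elim/I6_ind; by rewrite /shift2 !(tnth_inord _ 0).
- move=> x [u e]; exists (fun i => - u ((cusp_perm x)^-1%g i)).
  rewrite !gmulfV /= e perm_isomV; apply: perm_isomE => // i.
  by rewrite rmorphN.
move=> x y [u e] [v e']; exists (fun i => u i + v (cusp_perm x i)).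
rewrite !gmulfM /= e e' perm_isomM; apply: perm_isomE => // i.
by rewrite rmorphD.
Qed.

(** Computed for [a], then transported by [cusp_rep j], since conjugation only permutes the
    coordinates of a translation. *)
Lemma isom_cusp4 j :
  isom (cusp j ^+ 4)%g = perm_isom (fun i => ((i == j)%:R *+ 4)) 1.
Proof.
have H0 : isom (a ^+ 4)%g = perm_isom (fun i => ((i == inord 0)%:R *+ 4)) 1.
  rewrite !expgS expg0 mulg1 !gmulfM /= isom1 !perm_isomM.
  apply: perm_isomE; last first.
    apply/permP; elim/I6_ind; rewrite !permM perm1;
      by do 4 rewrite ?cusp_perm1 ?cusp_act1E //=.
  elim/I6_ind; rewrite /shift1 -val_eqE /= !inordK //=;
    by do 3 rewrite ?cusp_perm1 ?cusp_act1E //=; rewrite !(tnth_inord _ 0) //=; ring.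
rewrite /cusp -conjXg gmulfJ /= H0; have [u ->] := isomE (cusp_rep j).
rewrite perm_isomJ; apply: perm_isomE => // i; congr (_%:R *+ 4).
rewrite -(inj_eq (@perm_inj _ (cusp_perm (cusp_rep j)))) permKV.
by rewrite cusp_rep_perm.
Qed.

Lemma isom_twist : isom z = perm_isom (fun=> 1) 1.
Proof.
rewrite -cusp_perm_twist /full_twist !gmulfM /= isom1 isom2 !perm_isomM.
apply: perm_isomE => //; elim/I6_ind; rewrite !permM;
  by do 5 rewrite ?cusp_perm1 ?cusp_perm2 ?cusp_act1E ?cusp_act2E //=;
     rewrite /shift1 /shift2 !(tnth_inord _ 0) //=; ring.
Qed.

(** B_3[4] fixes all cusps, so it acts by translations, which commute. *)
Lemma isom_kernel x : x \in B3_4' -> isom x = 1%g.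
Proof.
apply: gcomm_kernel => {}x y /eqP/rho4_kernel px /eqP/rho4_kernel py.
rewrite /commute /=; have [u ->] := isomE x; have [v ->] := isomE y.
rewrite px py !perm_isomM; apply: perm_isomE => // i.
by rewrite !perm1 addrC.
Qed.

Notation Q := (quotient_group B3_4').
Notation proj := (quotient_map B3_4').

Definition isomQ : Q -> euclid R 6 := quotient_factor isom_kernel.
HB.instance Definition _ := UMagmaMorphism.on isomQ.

Lemma isomQE x : isomQ (proj x) = isom x.
Proof. exact: quotient_factorE. Qed.

Lemma isomQ_lattice u m :
  isomQ (lattice_elt u m) = perm_isom (fun i => (4 * u i + m)%:~R) 1.
Proof.
rewrite gmulfM gmulf_prod /=.
under eq_bigr => j _ do rewrite gmulf_expgz /= isomQE isom_cusp4 translationX.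
rewrite translation_prod gmulf_expgz /= isomQE isom_twist translationX perm_isomM.
apply: perm_isomE => [i|]; last by rewrite mul1g.
rewrite (bigD1 i) //= big1 => [|j /negPf ji].
  by rewrite eqxx addr0 rmorphD rmorphM /= -mulr_natr mul1r -[in LHS]mulrzr.
by rewrite eq_sym ji mul0rn mul0rz.
Qed.

(** An element acting trivially fixes the cusps, so it is a [lattice_elt v m] with 4 v_i + m = 0 for
    all i; then v is constant and [lattice_elt_const] applies. *)
Lemma isomQ_inj : injective isomQ.
Proof.
apply: gmulf_inj => y; have [x ->] := proj_surj y.
rewrite /= isomQE => ex; have [u] := isomE x; rewrite ex -perm_isom1.
move=> /perm_isom_inj[_ /esym/kernel_lattice[v [m e]]].
have := isomQE x; rewrite e ex isomQ_lattice -perm_isom1 => /perm_isom_inj[H _].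
have {}H i : m = - (4 * v i).
  by apply/eqP; rewrite -addr_eq0 addrC -(intr_eq0 R) H.
rewrite (H (inord 0)) (_ : v = fun=> v (inord 0)) ?lattice_elt_const //.
apply/funext => i; apply: (mulfI (isT : (4 : int) != 0)).
by apply: oppr_inj; rewrite -!H.
Qed.

End EuclideanBraid.

(** * Compactness of boxes of matrices and of O(d) *)

Section Compactness.
Import Order.TTheory GRing.Theory Num.Theory.
Import numFieldNormedType.Exports.
Local Open Scope classical_set_scope.
Local Open Scope ring_scope.
Variable R : realType.

(** The box is the image under [vec_mx] of a product of segments in a space of row vectors. *)
Lemma mx_box_compact m n (c : R) :
  compact [set M : 'M[R]_(m, n) | forall i j, `|M i j| <= c].
Proof.
have -> : [set M : 'M[R]_(m, n) | forall i j, `|M i j| <= c] =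
    vec_mx @` [set v : 'rV[R]_(m * n) | forall k, `[(- c), c]%classic (v ord0 k)].
  apply/seteqP; split=> [M Mc|_ [v vc <-] i j].
    exists (mxvec M); last exact: mxvecK.
    move=> k; rewrite /= in_itv /= -ler_norml.
    by case/mxvec_indexP: k => i j; rewrite mxvecE.
  by rewrite mxE ler_norml; have := vc (mxvec_index i j); rewrite /= in_itv.
apply: continuous_compact.
  apply: continuous_subspaceT => v A /nbhs_ballP[e e0 sA].
  apply/nbhs_ballP; exists e => // w [_ vw]; apply: sA; split=> // i j.
  by rewrite !mxE.
apply: (@rV_compact R _ (fun=> `[(- c), c]%classic)) => _.
exact: segment_compact.
Qed.

Lemma orth_mx_closed d : closed [set A : 'M[R]_d | A *m A^T = 1%:M].
Proof.
pose f (ij : 'I_d * 'I_d) (A : 'M[R]_d) : R := \sum_k A ij.1 k * A ij.2 k.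
have -> : [set A : 'M[R]_d | A *m A^T = 1%:M] =
    \bigcap_(ij in [set: 'I_d * 'I_d]) f ij @^-1` [set x | x = (ij.1 == ij.2)%:R].
  apply/seteqP; split=> [A /= AA ij _|A AA /=].
    have /matrixP/(_ ij.1 ij.2) := AA; rewrite !mxE => <-.
    by apply: eq_bigr => k _; rewrite mxE.
  apply/matrixP => i j; rewrite !mxE -(AA (i, j)) //.
  by apply: eq_bigr => k _; rewrite mxE.
apply: closed_bigI => ij _; apply: preimage_closed; last exact: closed_eq.
move=> A _; apply: continuous_big => [|k _ B]; first exact: add_continuous.
by apply: continuousM; exact: coord_continuous.
Qed.

Lemma orth_mx_le1 d (A : 'M[R]_d) : A *m A^T = 1%:M -> forall i j, `|A i j| <= 1.
Proof.
move=> AA i j; have /matrixP/(_ i i) := AA; rewrite !mxE eqxx => e.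
have : A i j ^+ 2 <= 1.
  rewrite -[leRHS]e (bigD1 j) //= mxE expr2 lerDl.
  by apply: sumr_ge0 => k _; rewrite mxE -expr2 sqr_ge0.
by rewrite -real_normK ?num_real // expr_le1 // normr_ge0.
Qed.

(** The orthogonal matrices are closed and bounded; as [orth] has the initial topology, a cluster
    point among the matrices lifts to one in [orth]. *)
Lemma orth_compact d : compact [set: orth R d].
Proof.
have cO : compact [set A : 'M[R]_d | A *m A^T = 1%:M].
  refine (subclosed_compact (@orth_mx_closed d) (@mx_box_compact d d 1) _).
  by move=> A /= AA; apply: orth_mx_le1.
move=> F FF _.
have [A [/eqP AA clA]] :=
  cO ((fun x : orth R d => \val x) @ F) _ (filterE _ (fun x => orth_mulmxT x)).
exists (exist _ A AA); split=> // U V FU [W [[B oB <-] WA] sWV].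
have /clA : (\val @ F) (\val @` U : set 'M[R]_d).
  by apply: (@filterS _ F _ U) => // x Ux; exists x.
move=> /(_ B (open_nbhs_nbhs (conj oB WA))) [_ [[x Ux <-] Bx]].
by exists x; split=> //; apply: sWV.
Qed.

End Compactness.

(** * The image of a morphism as a subgroup *)

Section MorphismImage.
Local Open Scope group_scope.
Variables (G H : groupType) (f : UMagmaMorphism.type G H).

Definition gimage : {pred H} := fun y => `[< exists x, y = f x >].

Lemma gimage_mulg_closed : mulg_closed gimage.
Proof.
move=> _ _ /asboolP[x ->] /asboolP[y ->]; apply/asboolP.
by exists (x * y); rewrite gmulfM.
Qed.

Lemma gimage1 : 1 \in gimage.
Proof. by apply/asboolP; exists 1; rewrite gmulf1. Qed.

Lemma gimage_invg_closed : invg_closed gimage.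
Proof. by move=> _ /asboolP[x ->]; apply/asboolP; exists x^-1; rewrite gmulfV. Qed.

HB.instance Definition _ := isMulClosed.Build H gimage gimage_mulg_closed.
HB.instance Definition _ := isMul1Closed.Build H gimage gimage1.
HB.instance Definition _ := isInvClosed.Build H gimage gimage_invg_closed.

End MorphismImage.

(** * Discreteness and cocompactness of the image *)

Section Crystallographic.
Import Order.TTheory GRing.Theory Num.Theory.
Import numFieldNormedType.Exports.
Local Open Scope classical_set_scope.
Local Open Scope ring_scope.
Variable R : realType.

(** Radius 1 isolates each point, because translation parts are integral and matrix entries are 0 or
    1. *)
Lemma isom_discrete : discrete_subgroup (gimage (isomQ R)).
Proof.
have isoE y : y \in gimage (isomQ R) ->
    exists (u : 'I_6 -> int) s, y = perm_isom (fun i => (u i)%:~R) s.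
  move=> /asboolP[x ->]; have [{}x ->] := proj_surj x.
  by rewrite /= isomQE; have [u ->] := isomE R x; eexists _, _.
move=> y /= Ky; split; first by rewrite inE.
exists [set p : euclid R 6 | ball y.1 1 p.1 /\ ball (\val y.2) 1 (\val p.2)].
  exists (ball y.1 1, (fun A : orth R 6 => \val A) @^-1` ball (\val y.2) 1).
    split; first exact: nbhsx_ballx.
    apply: (@initial_continuous (orth R 6) 'M[R]_6 (fun A => \val A) y.2).
    exact: nbhsx_ballx.
  by case=> v A [].
apply/seteqP; split=> [p [[[_ B1] [_ B2]] Kp]|_ ->]; last first.
  by split=> //; split; exact: ballxx.
have [u [s ey]] := isoE y Ky; have [v [t ep]] := isoE p Kp.
rewrite ey ep /= in B1 B2 *; apply: perm_isomE => [i|].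
  have := B1 i ord0; rewrite /ball /= !mxE -rmorphB /= -intr_norm ltrz1 => uv.
  have /eqP : `|u i - v i| = 0 by lia.
  by rewrite normr_eq0 subr_eq0 => /eqP ->.
apply/permP => i; have := B2 i (s i); rewrite /ball /= !mxE eqxx.
by case: eqP => // _; rewrite subr0 normr1 ltxx.
Qed.

(** Translations in [K] bring every coset into a compact set; the bound [c *+ d] arises because an
    orthogonal matrix has entries of absolute value at most 1. *)
Lemma uniform_translations d (K : groupClosed (euclid R d)) (c : R) :
    (forall w : 'cV[R]_d, exists2 t, (t, 1%g) \in K &
       forall i, `|(w + t) i ord0| <= c) ->
  uniform_subgroup K.
Proof.
move=> Kc; rewrite /uniform_subgroup.
pose C : set (euclid R d) :=
  [set v : 'cV[R]_d | forall i j, `|v i j| <= c *+ d] `*` [set: orth R d].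
have cC : compact C := compact_setX (@mx_box_compact R d 1 (c *+ d)) (@orth_compact R d).
have -> : [set: quotient_topology (coset_space K)] =
    (\pi_(quotient_topology (coset_space K)))%qT @` C.
  apply/seteqP; split=> // q _.
  have [[v A] ->] : exists x : euclid R d,
      q = (\pi_(quotient_topology (coset_space K)) x)%qT.
    by exists (generic_quotient.repr q); rewrite reprK.
  (* Right multiplication by (t, 1) turns v into v + A t = A (A^T v + t), so [t] is chosen for A^T
     v. *)
  have [t Kt wt] := Kc ((\val A)^T *m v).
  exists (v + \val A *m t, A).
    split=> // i j; rewrite ord1 {j} /=.
    have -> : v + \val A *m t = \val A *m ((\val A)^T *m v + t).
      by rewrite mulmxDr mulmxA orth_mulmxT mul1mx.
    rewrite mxE (le_trans (ler_norm_sum _ _ _)) //.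
    apply: (@le_trans _ _ (\sum_(k < d) c)); last by rewrite sumr_const card_ord.
    apply: ler_sum => k _; rewrite normrM -[c]mul1r ler_pM //.
    exact/orth_mx_le1/orth_mulmxT.
  apply/esym/eqmodP; rewrite /= /lcoset_eq.
  rewrite (_ : (_ * _)%g = ((t, 1%g) : euclid R d)) //.
  apply: (mulgI ((v, A) : euclid R d)); rewrite mulgA mulgV mul1g.
  by congr (_, _); rewrite mulg1.
apply: continuous_compact => //.
exact/continuous_subspaceT/pi_continuous.
Qed.

Lemma isom_uniform : uniform_subgroup (gimage (isomQ R)).
Proof.
apply: (@uniform_translations 6 _ 4) => w.
(* [lattice_elt n 0] translates by 4 n, which moves each coordinate into [0, 4). *)
pose n i : int := - Num.floor (w i ord0 / 4).
exists (\col_i (4 * n i)%:~R).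
  apply/asboolP; exists (lattice_elt n 0).
  rewrite /= isomQ_lattice /perm_isom; congr (_, _).
    by apply/colP => i; rewrite !mxE addr0.
  by apply: val_inj; rewrite /= perm_mx1.
move=> i; rewrite !mxE /n.
have /andP[] := Num.Theory.floor_itv (w i ord0 / 4).
rewrite mulrN rmorphN rmorphM /= intrD => h1 h2.
by rewrite ler_norml; apply/andP; split; lra.
Qed.

(** This makes the conjugation action on the c_j determine the permutation of the cusps, as
    faithfulness of the holonomy requires. *)
Lemma cusp4_inj : injective cusp4.
Proof.
move=> j k /(congr1 (isomQ R)); rewrite /cusp4 /= !isomQE !isom_cusp4.
move=> /perm_isom_inj[/(_ j) + _]; rewrite eqxx; case: eqP => // _ /eqP.
by rewrite mul0rn mulrn_eq0 oner_eq0.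
Qed.

Lemma lattice_elt_inj u v m n : lattice_elt u m = lattice_elt v n ->
  forall j, 4 * u j + m = 4 * v j + n.
Proof.
move=> /(congr1 (isomQ R)); rewrite /= !isomQ_lattice => /perm_isom_inj[e _] j.
by apply: (@intr_inj R); exact: e.
Qed.

Lemma lattice_eltP x : cusp_perm x = 1%g <->
  exists u m, quotient_map B3_4' x = lattice_elt u m.
Proof.
split; first exact: kernel_lattice.
case=> u [m] /(congr1 (isomQ R)); rewrite /= isomQE isomQ_lattice.
by have [v ->] := isomE R x => /perm_isom_inj[].
Qed.

End Crystallographic.

(** * The extension of S_4 by Z^6 *)

Section Holonomy.
Import GRing.Theory.
Local Open Scope ring_scope.
Variable R : realType.

Lemma B3_4'_diag_perm x : x \in B3_4' -> diag_perm x = 1%g.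
Proof. by move=> /B3_4'_cusp_perm/diag_perm_kernel. Qed.

(* The sixth coordinate is the exponent of z, as c_5 is redundant. *)
Definition lattice_map (v : 'cV[int]_6) : quotient_group B3_4' :=
  lattice_elt (fun j => if j == inord 5 then 0 else v j ord0) (v (inord 5) ord0).

Lemma lattice_map_surj u m : exists v, lattice_elt u m = lattice_map v.
Proof.
(* The relation with constant exponent -u_5 clears the exponent of c_5 and adds 4 u_5 to that of
   z. *)
exists (\col_j (if j == inord 5 then m + 4 * u j else u j - u (inord 5))).
rewrite -[LHS]mulg1 -(lattice_elt_const (- u (inord 5))) lattice_eltD /lattice_map.
congr lattice_elt; last by rewrite mxE eqxx mulrN opprK.
apply/funext => j; rewrite mxE; case: eqP => [->|//].
by rewrite subrr.
Qed.

Lemma isom_holonomy : has_holonomy 6 (quotient_group B3_4') 'S_4.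
Proof.
pose p : UMagmaMorphism.type (quotient_group B3_4') 'S_4 :=
  quotient_factor B3_4'_diag_perm.
have pE x : p (quotient_map B3_4' x) = diag_perm x by exact: quotient_factorE.
exists lattice_map, p; split.
- move=> u v; rewrite /lattice_map lattice_eltD; congr lattice_elt; last by rewrite mxE.
  by apply/funext => j; rewrite mxE; case: eqP => // _; rewrite addr0.
- move=> u v /(lattice_elt_inj R) e; apply/colP => j.
  (* The coordinate 5 compares the exponents of z; once they agree, the factor 4 cancels in the
     others. *)
  have e5 := e (inord 5); rewrite eqxx !mulr0 !add0r in e5.
  have := e j; rewrite e5; case: eqP => [-> _ //|_ /addIr].
  by apply: mulfI.
- move=> x; have [y ->] := proj_surj x; rewrite pE; split.
    move=> /diag_perm_kernel/kernel_lattice[u [m ->]]; exact: lattice_map_surj.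
  by case=> u e; apply/diag_perm_kernel/(lattice_eltP R); rewrite e; eexists _, _.
- move=> s; have [x <-] := diag_perm_surj s.
  by exists (quotient_map B3_4' x); exact: pE.
move=> x y; have [{}x ->] := proj_surj x; have [{}y ->] := proj_surj y => H.
rewrite !pE; apply/divg1_eq; rewrite -gmulfF; apply/diag_perm_kernel.
rewrite gmulfF /=; apply/eqP; rewrite divg_eq1 -eqg_inv; apply/eqP/permP => j.
have [v vE] := lattice_map_surj (fun i => Posz (i == j)) 0.
have := H v; rewrite -vE lattice_elt_cusp4.
(* Conjugation here is by w on the left, hence the inverse permutation. *)
have cE w : (quotient_map B3_4' w * cusp4 j * (quotient_map B3_4' w)^-1)%g =
    cusp4 ((cusp_perm w)^-1%g j).
  have -> : ((cusp_perm w)^-1)%g = cusp_perm w^-1%g by rewrite gmulfV.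
  by rewrite -cusp4J projV conjgE invgK mulgA.
by rewrite !cE => /(cusp4_inj R).
Qed.

End Holonomy.

Theorem proposition3p8 (R : realType) :
  crystallographic R 6 (quotient_group (gcomm B3_4 B3_4)) /\
  has_holonomy 6 (quotient_group (gcomm B3_4 B3_4)) 'S_4.
Proof.
split; last exact: isom_holonomy R.
pose K : groupClosed (euclid R 6) := gimage (isomQ R).
pose f : UMagmaMorphism.type (quotient_group B3_4') (euclid R 6) := isomQ R.
exists K, f; split.
- exact: isom_discrete.
- exact: isom_uniform.
- exact: isomQ_inj.
- by move=> y; split=> [/asboolP|?] //; exact/asboolP.
Qed.
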